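(* Let $H$ be a finite dimensional hereditary algebra over a field $k$, let $m\ge 2$, and let $X_0\to X_1\to\cdots\to X_r$ be a sectional path in $\mathbf{C}_{\equiv m}(\operatorname{proj}H)$. If $f_i:X_{i-1}\to X_i$ are irreducible morphisms for $i=1,\dots,r$, then $f_r\cdots f_1\notin\Re^{r+1}_{\mathbf{C}_{\equiv m}(\operatorname{proj}H)}(X_0,X_r)$. In particular, the composition $f_r\cdots f_1$ does not vanish.
   Context: $\operatorname{proj}H$ is the category of finitely generated projective $H$-modules. $\mathbf{C}_{\equiv m}(\operatorname{proj}H)$ is the category of $m$-periodic complexes: complexes $X=(X^i,d_X^i)_{i\in\mathbb{Z}}$ over $\operatorname{proj}H$ with $X^i=X^j$, $d_X^i=d_X^j$ whenever $i\equiv j\pmod m$; morphisms are chain maps $(f^i)$ with $f^i=f^j$ whenever $i\equiv j\pmod m$. It carries the exact structure whose conflations are split exact in each degree; almost split sequences are conflations $X\xrightarrow{f}Y\xrightarrow{g}Z$ with $f$ minimal left almost split and $g$ minimal right almost split, and then $\tau^{-1}_{\mathbf{C}_{\equiv m}}X=Z$. A morphism is irreducible if it is neither a section nor a retraction and, whenever $f=hg$, either $g$ is a section or $h$ is a retraction. A path $X_0\to X_1\to\cdots\to X_r$ of irreducible morphisms between indecomposable complexes is sectional if $\tau^{-1}_{\mathbf{C}_{\equiv m}}X_i\not\simeq X_{i+2}$ for every $i=0,\dots,r-2$ (the condition holds automatically when $X_i$ is not the starting term of an almost split sequence). $\Re^{s}_{\mathcal{C}}$ denotes the $s$-th power of the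 Jacobson radical $\Re_{\mathcal{C}}$ of the category $\mathcal{C}$. *)

(* Defs.v *)
From HB Require Import structures.
From mathcomp Require Import all_boot all_order all_algebra all_field.

Set Implicit Arguments.
Unset Strict Implicit.
Unset Printing Implicit Defensive.

Import GRing.Theory.
Local Open Scope ring_scope.

Section Modules.
Variable H : nzRingType.

Definition fin_gen (M : lmodType H) : Prop :=
  exists (n : nat) (e : 'I_n -> M),
    forall x : M, exists c : 'I_n -> H, x = \sum_(j < n) c j *: e j.

Definition projective (P : lmodType H) : Prop :=
  forall (M N : lmodType H) (p : {linear M -> N}) (f : {linear P -> N}),
    (forall y, exists x, p x = y) ->
    exists h : {linear P -> M}, p \o h =1 f.

(* Submodules are given by injective linear maps.  Only left modules occur;
   for finite dimensional algebras left and right hereditary agree. *)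
Definition hereditary : Prop :=
  forall (P Q : lmodType H) (j : {linear Q -> P}),
    projective P -> injective j -> projective Q.

End Modules.

Section PeriodicComplexes.
Variables (H : nzRingType) (m : nat).

(* An m-periodic family indexed by the integers is a family indexed by the
   residues 'I_m; ordS is the cyclic successor i |-> i + 1 mod m. *)
Record pcomplex := PComplex {
  pobj :> 'I_m -> lmodType H;
  pdiff : forall i, {linear pobj i -> pobj (ordS i)};
  pobj_fin_gen : forall i, fin_gen (pobj i);
  pobj_projective : forall i, projective (pobj i);
  pdiff_sq0 : forall i (x : pobj i), pdiff (ordS i) (pdiff i x) = 0
}.

Record phom (X Y : pcomplex) := PHom {
  pmap :> forall i, {linear X i -> Y i};
  pmap_comm : forall i (x : X i),
    pmap (ordS i) (pdiff X i x) = pdiff Y i (pmap i x)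
}.

Definition pheq X Y (f g : phom X Y) : Prop := forall i, f i =1 g i.

Fact phom_id_comm (X : pcomplex) i (x : X i) :
  idfun (pdiff X i x) = pdiff X i (idfun x).
Proof. by []. Qed.

Definition phom_id (X : pcomplex) : phom X X :=
  @PHom X X (fun i => idfun) (@phom_id_comm X).

Fact phom_comp_comm (X Y Z : pcomplex) (g : phom Y Z) (f : phom X Y) i (x : X i) :
  (g (ordS i) \o f (ordS i)) (pdiff X i x) = pdiff Z i ((g i \o f i) x).
Proof. by rewrite /= !pmap_comm. Qed.

Definition phom_comp X Y Z (g : phom Y Z) (f : phom X Y) : phom X Z :=
  @PHom X Z (fun i => g i \o f i) (phom_comp_comm g f).

Fact phom_zero_comm (X Y : pcomplex) i (x : X i) :
  (\0 : X (ordS i) -> Y (ordS i)) (pdiff X i x)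
    = pdiff Y i ((\0 : X i -> Y i) x).
Proof. by rewrite /= linear0. Qed.

Definition phom_zero X Y : phom X Y :=
  @PHom X Y (fun i => \0) (@phom_zero_comm X Y).

Fact phom_add_comm (X Y : pcomplex) (f g : phom X Y) i (x : X i) :
  (f (ordS i) \+ g (ordS i)) (pdiff X i x) = pdiff Y i ((f i \+ g i) x).
Proof. by rewrite /= !pmap_comm linearD. Qed.

Definition phom_add X Y (f g : phom X Y) : phom X Y :=
  @PHom X Y (fun i => f i \+ g i) (phom_add_comm f g).

Fact phom_sub_comm (X Y : pcomplex) (f g : phom X Y) i (x : X i) :
  (f (ordS i) \- g (ordS i)) (pdiff X i x) = pdiff Y i ((f i \- g i) x).
Proof. by rewrite /= !pmap_comm linearB. Qed.

Definition phom_sub X Y (f g : phom X Y) : phom X Y :=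
  @PHom X Y (fun i => f i \- g i) (phom_sub_comm f g).


Notation "f === g" := (pheq f g) (at level 70, no associativity).
Notation "g \oc f" := (phom_comp g f) (at level 40, left associativity).

Implicit Types W X Y Z : pcomplex.

Definition is_section X Y (f : phom X Y) : Prop :=
  exists r : phom Y X, r \oc f === phom_id X.

Definition is_retraction X Y (f : phom X Y) : Prop :=
  exists s : phom Y X, f \oc s === phom_id Y.

Definition is_iso X Y (f : phom X Y) : Prop :=
  exists g : phom Y X, g \oc f === phom_id X /\ f \oc g === phom_id Y.

Definition isomorphic X Y : Prop := exists f : phom X Y, is_iso f.

Definition is_zero X : Prop := forall i (x : X i), x = 0.

Definition is_biproduct X A B : Prop :=
  exists (iA : phom A X) (iB : phom B X) (pA : phom X A) (pB : phom X B),
    [/\ pA \oc iA === phom_id A,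
        pB \oc iB === phom_id B,
        pA \oc iB === phom_zero B A,
        pB \oc iA === phom_zero A B &
        phom_add (iA \oc pA) (iB \oc pB) === phom_id X].

Definition indecomposable X : Prop :=
  ~ is_zero X /\ forall A B, is_biproduct X A B -> is_zero A \/ is_zero B.

Definition irreducible X Y (f : phom X Y) : Prop :=
  [/\ ~ is_section f,
      ~ is_retraction f &
      forall W (g : phom X W) (h : phom W Y),
        f === h \oc g -> is_section g \/ is_retraction h].

Definition left_almost_split X Y (f : phom X Y) : Prop :=
  ~ is_section f /\
  forall W (u : phom X W), ~ is_section u ->
    exists v : phom Y W, v \oc f === u.

Definition right_almost_split Y Z (g : phom Y Z) : Prop :=
  ~ is_retraction g /\
  forall W (u : phom W Z), ~ is_retraction u ->
    exists v : phom W Y, g \oc v === u.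

Definition left_minimal X Y (f : phom X Y) : Prop :=
  forall e : phom Y Y, e \oc f === f -> is_iso e.

Definition right_minimal Y Z (g : phom Y Z) : Prop :=
  forall e : phom Y Y, g \oc e === g -> is_iso e.

(* Each 0 -> X i -> Y i -> Z i -> 0 is exact and splits; the splittings need
   not be compatible with the differentials. *)
Definition conflation X Y Z (f : phom X Y) (g : phom Y Z) : Prop :=
  forall i,
    [/\ injective (f i),
        forall y : Y i, g i y = 0 <-> exists x, f i x = y &
        exists s : {linear Z i -> Y i}, g i \o s =1 idfun].

Definition almost_split_seq X Y Z (f : phom X Y) (g : phom Y Z) : Prop :=
  [/\ conflation f g,
      left_almost_split f, left_minimal f,
      right_almost_split g & right_minimal g].

(* Z is tau^{-1} X. *)
Definition is_tau_inv X Z : Prop :=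
  exists (Y : pcomplex) (f : phom X Y) (g : phom Y Z), almost_split_seq f g.

Definition radical X Y (f : phom X Y) : Prop :=
  forall g : phom Y X, is_iso (phom_sub (phom_id X) (g \oc f)).

(* Powers of the ideal [radical]: the 0-th power is the whole category, so
   the first power is [radical] itself. *)
Fixpoint radical_pow (s : nat) X Y (f : phom X Y) : Prop :=
  if s is s'.+1 then
    exists (n : nat) (Z : 'I_n -> pcomplex)
           (h : forall j, phom X (Z j)) (g : forall j, phom (Z j) Y),
      [/\ forall j, radical (h j),
          forall j, radical_pow s' (g j) &
          f === \big[@phom_add X Y/phom_zero X Y]_(j < n) (g j \oc h j)]
  else True.

(* Paths of length r are given by sequences indexed by nat, of which only
   the terms X 0, ..., X r (and the morphisms between them) matter. *)
Definition sectional_path (r : nat) (X : nat -> pcomplex) : Prop :=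
  [/\ forall i, (i <= r)%N -> indecomposable (X i),
      forall i, (i < r)%N -> exists f : phom (X i) (X i.+1), irreducible f &
      forall i, (i.+2 <= r)%N ->
        forall Z, is_tau_inv (X i) Z -> ~ isomorphic Z (X i.+2)].

(* f (n-1) \oc ... \oc f 0 *)
Fixpoint path_comp (X : nat -> pcomplex) (f : forall i, phom (X i) (X i.+1))
    (n : nat) : phom (X 0%N) (X n) :=
  if n is n'.+1 then f n' \oc path_comp f n' else phom_id (X 0%N).

End PeriodicComplexes.

(* Main.v *)
From HB Require Import structures.
Require Import Defs.
From mathcomp Require Import all_boot all_order all_algebra all_field.
From mathcomp Require Import boolp zify.

(** The argument is that of Igusa and Todorov. Suppose that [f_r ... f_1] lies
    in the power [r + 1] of the radical. Let [c : X_0 -> E] be the start of the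
    almost split sequence [X_0 -> E -> tau^-1 X_0]. As [c] is left almost split,
    [f_1 = a c], and the given expression of [f_r ... f_1] as a sum of products
    of radical morphisms is [w c] with [w] in the power [r] of the radical.
    Hence [f_r ... f_2 a - w] vanishes on [X_0] and factors through
    [tau^-1 X_0]. Since [f_1] is irreducible, [a] is a retraction; along a
    section of it, [f_r ... f_2] is congruent to some [v p] modulo the power [r]
    of the radical, where [p : X_1 -> tau^-1 X_0] is irreducible. The step is
    repeated at [X_1] with [p] carried along: since [X_2] and [tau^-1 X_0] are
    not isomorphic, [f_2] and [p] are jointly split off by the almost split map
    starting at [X_1] ([joint_retraction]), and the term [v p] disappears along
    a suitable section. This is [sectional_step]. At the end of the path the
    identity of [X_r] is congruent to some [v p] modulo the radical, so that [p]
    is a section, which is impossible ([sectional_path_rad_power]).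

    No almost split sequence starts at a contractible [X_i]. There, [c] is
    replaced by the map with components [f_(i+1)], [p] and the radical morphisms
    of the given expression. The kernel [K] of the morphism [u] that vanishes
    on [X_i] is a complex of projectives and a degreewise summand, because [H]
    is hereditary; as contractible complexes are injective relative to
    degreewise split sequences, [X_i -> K] is still not a section, so [X_(i+1)]
    is a summand of [K], and [u] vanishes on it.

    Existence of almost split sequences ([almost_split_exists]). Extensions of
    [W] by [X] are morphisms [W -> shift X] up to [null]. A nonsplit extension of
    an indecomposable [Z] by [X] that splits after pullback along every radical
    morphism to [Z] is almost split ([almost_split_ext]). To find one, take a
    test object [V], such that every nonsplit extension of any [W] by [X] stays
    nonsplit after pullback along some [V -> W] ([test_object]). By finite
    dimension of [End(V)] some nonsplit extension of [V] is killed by its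
    radical, hence, [V] being a test object, by every radical morphism to [V]
    ([socle]); then restrict it to an indecomposable summand of [V]. The test
    object comes from duality: over a hereditary algebra the splitting may be
    checked in each degree separately ([degreewise_null]), where it is a linear
    system over [k]. A functional certifying that this system has no solution
    amounts to a morphism to [W] from a fixed two term complex of free modules,
    whose matrix lists the relations between functionals spanning the [k]-dual
    of the cokernel of a differential of [X]. *)

Set Implicit Arguments.
Unset Strict Implicit.
Unset Printing Implicit Defensive.

Import GRing.Theory VectorInternalTheory.
Local Open Scope ring_scope.

(** * Modules over a ring *)
Section Linear.
Variable H : nzRingType.
Implicit Types A B C M P Q : lmodType H.

(** Equality of morphisms of complexes is made into Leibniz equality by means of
    this lemma, so that they can be rewritten. *)
Lemma linear_ext A B (f g : {linear A -> B}) : f =1 g -> f = g.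
Proof.
case: f => f [[f1] [f2]]; case: g => g [[g1] [g2]] /= fg.
have e : f = g by apply: funext.
case: g / e g1 g2 fg => g1 g2 _.
by rewrite (Prop_irrelevance f1 g1) (Prop_irrelevance f2 g2).
Qed.

Definition mklin A B (f : A -> B) (lf : linear f) : {linear A -> B} :=
  HB.pack f (GRing.isLinear.Build H A B *:%R f lf).

Section Submodule.
Variables (A : lmodType H) (S : A -> Prop).
Hypothesis S0 : S 0.
Hypothesis SL : forall a u v, S u -> S v -> S (a *: u + v).

Definition submod_pred of S 0 & (forall a u v, S u -> S v -> S (a *: u + v))
  : {pred A} := [pred x | `[< S x >]].

Fact submod_pred_closed : submod_closed (submod_pred S0 SL).
Proof.
split; first by apply/asboolP.
by move=> a u v /asboolP Su /asboolP Sv; apply/asboolP; apply: SL.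
Qed.

HB.instance Definition _ :=
  GRing.isSubmodClosed.Build H A (submod_pred S0 SL) submod_pred_closed.

Record submod := Submod { subval : A; subvalP : subval \in submod_pred S0 SL }.

HB.instance Definition _ := [isSub for subval].
HB.instance Definition _ := [Choice of submod by <:].
HB.instance Definition _ := [SubChoice_isSubLmodule of submod by <:].

Lemma submodP (x : submod) : S (val x).
Proof. by apply/asboolP; exact: (valP x). Qed.

Definition submod_in x (Sx : S x) : submod := Submod (introT (asboolP _) Sx).

Lemma subval_is_linear : linear (val : submod -> A).
Proof. by move=> a u v; rewrite linearP. Qed.

Definition sub_incl : {linear submod -> A} := mklin subval_is_linear.

Lemma sub_corestr_is_linear B (f : {linear B -> A}) (Sf : forall x, S (f x)) :
  linear (fun x => submod_in (Sf x)).
Proof. by move=> a u v; apply: val_inj; rewrite [RHS]linearP; apply: linearP. Qed.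

Definition sub_corestr B (f : {linear B -> A}) (Sf : forall x, S (f x)) :
  {linear B -> submod} := mklin (sub_corestr_is_linear Sf).
End Submodule.

Fact ker_closed0 A B (g : {linear A -> B}) : g 0 = 0.
Proof. exact: linear0. Qed.

Fact ker_closedL A B (g : {linear A -> B}) a u v :
  g u = 0 -> g v = 0 -> g (a *: u + v) = 0.
Proof. by move=> gu gv; rewrite linearP gu gv scaler0 addr0. Qed.

Definition ker_mod A B (g : {linear A -> B}) : lmodType H :=
  submod (ker_closed0 g) (@ker_closedL _ _ g).

Fact im_closed0 A B (g : {linear A -> B}) : exists x, g x = 0.
Proof. by exists 0; rewrite linear0. Qed.

Fact im_closedL A B (g : {linear A -> B}) a u v :
  (exists x, g x = u) -> (exists x, g x = v) -> exists x, g x = a *: u + v.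
Proof. by move=> [x <-] [y <-]; exists (a *: x + y); rewrite linearP. Qed.

Definition im_mod A B (g : {linear A -> B}) : lmodType H :=
  submod (im_closed0 g) (@im_closedL _ _ g).

Definition ker_incl A B (g : {linear A -> B}) : {linear ker_mod g -> A} :=
  sub_incl (ker_closed0 g) (@ker_closedL _ _ g).

Definition ker_corestr A B C (g : {linear A -> B}) (f : {linear C -> A})
    (gf0 : forall x, g (f x) = 0) : {linear C -> ker_mod g} :=
  @sub_corestr _ _ (ker_closed0 g) (@ker_closedL _ _ g) C f gf0.

Definition im_incl A B (g : {linear A -> B}) : {linear im_mod g -> B} :=
  sub_incl (im_closed0 g) (@im_closedL _ _ g).

Definition im_corestr A B C (g : {linear A -> B}) (f : {linear C -> B})
    (im_f : forall x, exists y, g y = f x) : {linear C -> im_mod g} :=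
  @sub_corestr _ _ (im_closed0 g) (@im_closedL _ _ g) C f im_f.

Lemma im_incl_inj A B (g : {linear A -> B}) : injective (im_incl g).
Proof. exact: val_inj. Qed.

Lemma ker_incl_inj A B (g : {linear A -> B}) : injective (ker_incl g).
Proof. exact: val_inj. Qed.

Lemma ker_inclP A B (g : {linear A -> B}) x : g (ker_incl g x) = 0.
Proof. exact: (submodP x). Qed.

Lemma im_inclP A B (g : {linear A -> B}) x : exists y, g y = im_incl g x.
Proof. exact: (submodP x). Qed.

(** The image of [d] is a module onto which [d] is surjective, which reduces the
    lifting to the defining property of [P]. *)
Lemma projective_lift P A B (d : {linear A -> B}) (f : {linear P -> B}) :
  projective P -> (forall x, exists y, d y = f x) ->
  exists s : {linear P -> A}, forall x, d (s x) = f x.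
Proof.
move=> projP im_f.
have im_d y : exists x, d x = d y by exists y.
pose p : {linear A -> im_mod d} := im_corestr im_d.
pose f' : {linear P -> im_mod d} := im_corestr im_f.
have surj_p y : exists x, p x = y.
  by have [x dx] := im_inclP y; exists x; apply: im_incl_inj.
have [s ps] := projP _ _ p f' surj_p.
by exists s => x; have /(congr1 val) := ps x.
Qed.

(** Over a hereditary ring the image of [f] is projective, so that the
    surjection onto it splits and the kernel is a direct summand. *)
Lemma hereditary_ker_proj P Q (f : {linear Q -> P}) :
  hereditary H -> projective P ->
  exists e : {linear Q -> Q},
    (forall x, f (e x) = 0) /\ (forall x, f x = 0 -> e x = x).
Proof.
move=> herH projP.
have projI : projective (im_mod f).
  apply: (herH _ _ (im_incl f) projP).
  exact: val_inj.
have [s fs] := projective_lift (d := f)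
  (f := im_incl f) projI (@im_inclP _ _ f).
have im_f x : exists y, f y = f x by exists x.
pose f' : {linear Q -> im_mod f} := im_corestr im_f.
have lin_e : linear (fun x => x - s (f' x)).
  move=> a u v; rewrite (linearP f') (linearP s) scalerBr opprD.
  by rewrite !addrA; congr (_ - _); rewrite addrAC.
have eE x : mklin lin_e x = x - s (f' x) by [].
exists (mklin lin_e); split=> x; rewrite eE; first by rewrite linearB fs subrr.
move=> fx0; have -> : f' x = 0 by apply: im_incl_inj.
by rewrite linear0 subr0.
Qed.

(** The kernel is a retract of [Q]. *)
Lemma ker_mod_fin_gen_proj P Q (f : {linear Q -> P}) :
  hereditary H -> projective P -> projective Q -> fin_gen Q ->
  fin_gen (ker_mod f) /\ projective (ker_mod f).
Proof.
move=> herH projP projQ [n [g gen_g]].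
have [e [fe eK]] := hereditary_ker_proj f herH projP.
pose p : {linear Q -> ker_mod f} := ker_corestr fe.
have pK (x : ker_mod f) : p (ker_incl f x) = x.
  by apply: ker_incl_inj; apply: eK; apply: ker_inclP.
split.
  exists n, (fun j => p (g j)) => x; have [c xE] := gen_g (ker_incl f x).
  exists c; rewrite -[LHS]pK xE linear_sum.
  by apply: eq_bigr => j _; rewrite linearZ.
move=> M N q h surj_q.
have [t qt] := projQ _ _ q (h \o p) surj_q.
exists (t \o ker_incl f) => x /=.
by rewrite [LHS](qt (ker_incl f x)) [LHS](congr1 h (pK x)).
Qed.

Fact prod_inl_is_linear A B : linear (fun x : A => (x, 0) : A * B).
Proof. by move=> a u v; congr (_, _); rewrite /= scaler0 addr0. Qed.

Fact prod_inr_is_linear A B : linear (fun y : B => (0, y) : A * B).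
Proof. by move=> a u v; congr (_, _); rewrite /= scaler0 addr0. Qed.

Definition prod_inl A B : {linear A -> (A * B)%type} :=
  mklin (@prod_inl_is_linear A B).
Definition prod_inr A B : {linear B -> (A * B)%type} :=
  mklin (@prod_inr_is_linear A B).

Lemma prod_split A B (z : A * B) : z = prod_inl A B z.1 + prod_inr A B z.2.
Proof. by case: z => x y; congr (_, _); rewrite /= (addr0, add0r). Qed.

Lemma fin_gen_prod A B : fin_gen A -> fin_gen B -> fin_gen (A * B)%type.
Proof.
move=> [n [g gen_g]] [n' [g' gen_g']].
exists (n + n')%N, (fun j => match split j with
  | inl j => prod_inl A B (g j) | inr j => prod_inr A B (g' j) end) => z.
have [c xE] := gen_g z.1; have [c' yE] := gen_g' z.2.
exists (fun j => match split j with inl j => c j | inr j => c' j end).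
rewrite big_split_ord [LHS]prod_split xE yE !linear_sum.
congr (_ + _); apply: eq_bigr => j _; rewrite linearZ.
  by rewrite (unsplitK (inl j)).
by rewrite (unsplitK (inr j)).
Qed.

Lemma projective_prod A B :
  projective A -> projective B -> projective (A * B)%type.
Proof.
move=> projA projB M N q h surj_q.
have [s qs] := projA _ _ q (h \o prod_inl A B) surj_q.
have [t qt] := projB _ _ q (h \o prod_inr A B) surj_q.
have lin_st : linear (fun z : A * B => s z.1 + t z.2).
  by move=> a u v; rewrite /= !linearP scalerDr addrACA.
exists (mklin lin_st) => z /=.
rewrite linearD [X in X + _](qs z.1) [X in _ + X](qt z.2) /=.
by rewrite -linearD -prod_split.
Qed.

Lemma lincomb_is_linear n (M : lmodType H) (g : 'I_n -> M) :
  linear (fun v : 'rV[H]_n => \sum_j v 0 j *: g j).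
Proof.
move=> a u v; rewrite scaler_sumr -big_split; apply: eq_bigr => j _ /=.
by rewrite !mxE scalerDl scalerA.
Qed.

Definition lincomb n (M : lmodType H) (g : 'I_n -> M) :
  {linear 'rV[H]_n -> M} := mklin (lincomb_is_linear g).

Lemma lincomb_delta n (M : lmodType H) (g : 'I_n -> M) j :
  lincomb g (delta_mx 0 j) = g j.
Proof.
rewrite /= (bigD1 j) //= mxE !eqxx scale1r big1 ?addr0 // => i ij.
by rewrite mxE eqxx (negPf ij) scale0r.
Qed.

Lemma lincomb_comp n (M N : lmodType H) (g : 'I_n -> M) (h : {linear M -> N}) v :
  h (lincomb g v) = lincomb (fun j => h (g j)) v.
Proof. by rewrite /= linear_sum; apply: eq_bigr => j _; rewrite linearZ. Qed.

Lemma rV_lincomb n (v : 'rV[H]_n) : v = lincomb (fun j => delta_mx 0 j) v.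
Proof. exact: row_sum_delta. Qed.

Lemma fin_gen_rV n : fin_gen 'rV[H]_n.
Proof.
exists n, (fun j => delta_mx 0 j) => v; exists (fun j => v 0 j).
exact: rV_lincomb.
Qed.

Lemma projective_rV n : projective 'rV[H]_n.
Proof.
move=> M N q h surj_q.
have [g qg] : exists g : 'I_n -> M, forall j, q (g j) = h (delta_mx 0 j).
  by apply: (fin_all_exists (P := fun j x => q x = h (delta_mx 0 j))) => j.
exists (lincomb g) => v; rewrite [in RHS](rV_lincomb v).
rewrite [LHS]lincomb_comp [RHS]lincomb_comp.
by apply: eq_bigr => j _; rewrite qg.
Qed.

(** A bound on the number of generators may be increased at will; this allows
    to use one bound for the finitely many terms of a periodic complex. *)
Lemma fin_gen_retract P :
  fin_gen P -> projective P -> exists n0, forall n, (n0 <= n)%N ->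
  exists (i : {linear P -> 'rV[H]_n}) (p : {linear 'rV[H]_n -> P}),
    forall x, p (i x) = x.
Proof.
move=> [n0 [g gen_g]] projP; exists n0 => n le_n.
pose g' (j : 'I_n) := if insub (val j) is Some j' then g j' else 0.
have surj_p y : exists x, lincomb g' x = y.
  have [c ->] := gen_g y.
  exists (\sum_j c j *: delta_mx 0 (widen_ord le_n j)).
  rewrite linear_sum; apply: eq_bigr => j _; rewrite linearZ; congr (_ *: _).
  by rewrite lincomb_delta /g' /= valK.
have [i pi] := projP _ _ (lincomb g') idfun surj_p.
by exists i, (lincomb g').
Qed.

End Linear.

(** * Linear algebra over a field *)
Section LinearAlgebra.
Variable k : fieldType.

(** A matrix of maximal rank with rows in [S]. *)
Lemma subspace_matrix n (S : 'rV[k]_n -> Prop) :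
  S 0 -> (forall a u v, S u -> S v -> S (a *: u + v)) ->
  exists B : 'M[k]_n, forall u, S u <-> (u <= B)%MS.
Proof.
move=> S0 SL.
suff grow d (B : 'M[k]_n) : (n - \rank B <= d)%N ->
    (forall u, (u <= B)%MS -> S u) ->
    exists B : 'M[k]_n, forall u, S u <-> (u <= B)%MS.
  apply: (grow n 0); first by rewrite mxrank0 subn0.
  by move=> u; rewrite submx0 => /eqP->.
elim: d B => [|d IHd] B rkB BS.
  exists B => u; split=> [_|]; last exact: BS.
  by apply: submx_full; rewrite /row_full eqn_leq rank_leq_col -subn_eq0 -leqn0.
have [maxB|] := EM (forall u, S u -> (u <= B)%MS).
  by exists B => u; split; [apply: maxB | apply: BS].
move=> /existsNP[u /not_implyP[Su /negP uB]].
apply: (IHd (B + u)%MS).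
  have: (\rank B < \rank (B + u)%MS)%N.
    rewrite ltn_neqAle mxrankS ?addsmxSl // andbT; apply: contra uB => /eqP rk.
    have /eqmxP/eqmx_sym BuE : (B == B + u)%MS.
      by rewrite -(mxrank_leqif_eq (addsmxSl B u)) rk.
    by rewrite -BuE addsmxSr.
  by lia.
move=> w /sub_addsmxP[[x y] /= ->]; rewrite addrC.
have [a ->] : exists a, y = a%:M by exists (y 0 0); apply: mx11_scalar.
by rewrite mul_scalar_mx; apply: SL => //; apply: BS; apply: submxMl.
Qed.

(** A subspace of a finite dimensional space is the common zero set of the
    functionals vanishing on it; indexing coordinates by a finite type allows
    families of vectors to be treated as vectors. *)
Lemma separation (D : finType) (S : (D -> k) -> Prop) (F : D -> k) :
  S (fun=> 0) -> (forall a F G, S F -> S G -> S (fun d => a * F d + G d)) ->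
  ~ S F ->
  exists c : D -> k,
    (forall G, S G -> \sum_d c d * G d = 0) /\ \sum_d c d * F d <> 0.
Proof.
move=> S0 SL nSF.
pose S' (u : 'rV[k]_#|D|) := S (fun d => u 0 (enum_rank d)).
have S'0 : S' 0.
  by rewrite /S'; under eq_fun do rewrite mxE.
have S'L a u v : S' u -> S' v -> S' (a *: u + v).
  move=> Su Sv; have := SL a _ _ Su Sv.
  by congr S; apply: funext => d; rewrite !mxE.
have [B SB] := subspace_matrix S'0 S'L.
pose r (G : D -> k) : 'rV[k]_#|D| := \row_t G (enum_val t).
have Sr G : S G <-> (r G <= B)%MS.
  rewrite -SB /S' (_ : (fun d => _) = G) //.
  by apply: funext => d; rewrite mxE enum_rankK.
have nFB : r F *m cokermx B != 0.
  by apply/negP => /eqP FB; apply/nSF/Sr; rewrite submxE FB.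
have [j Fj] : exists j, (r F *m cokermx B) 0 j <> 0.
  apply: contrapT => /forallNP F0; case/negP: nFB; apply/eqP/rowP => j.
  by rewrite [RHS]mxE; apply: contrapT; apply: F0.
pose c d := cokermx B (enum_rank d) j.
have cE G : \sum_d c d * G d = (r G *m cokermx B) 0 j.
  rewrite mxE (reindex_onto enum_rank enum_val); last by move=> *; apply: enum_valK.
  apply: eq_big => [d|d _]; first by rewrite enum_rankK eqxx.
  by rewrite mxE enum_rankK mulrC.
exists c; split=> [G /Sr|]; rewrite cE //.
by rewrite submxE => /eqP ->; rewrite mxE.
Qed.

Lemma vect_subspace_gen (V : vectType k) (S : V -> Prop) :
  S 0 -> (forall a u v, S u -> S v -> S (a *: u + v)) ->
  exists A : 'I_(\dim {:V}) -> V, (forall c, S (A c)) /\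
    forall v, S v -> exists w : 'I_(\dim {:V}) -> k, v = \sum_c w c *: A c.
Proof.
move=> S0 SL; rewrite dimvf.
have [|a u v Su Sv|B SB] := @subspace_matrix _ (fun u => S (r2v u)).
- by rewrite linear0.
- by rewrite linearP; apply: SL.
exists (fun c => r2v (row c B)); split=> [c|v]; first exact/SB/row_sub.
rewrite -(v2rK v) => /SB/submxP[w ->]; exists (fun c => w 0 c).
rewrite mulmx_sum_row linear_sum.
by apply: eq_bigr => c _; rewrite linearZ.
Qed.

(** In a nontrivial relation between terms of the sequence, solve for the term
    with the least index. Finite dimension of morphism spaces is used in this
    form. *)
Lemma vect_seq_dep (V : vectType k) (u : nat -> V) :
  exists l n (c : 'I_n -> k), u l = \sum_(i < n) c i *: u (l.+1 + i)%N.
Proof.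
pose N := (\dim {:V}).+1.
suff [l [lN ul]] : exists l, (l < N)%N /\
    u l \in <<[seq u i | i <- iota l.+1 (N - l.+1)]>>%VS.
  set s := [seq u i | i <- _] in ul.
  have size_s : size s = (N - l.+1)%N by rewrite size_map size_iota.
  exists l, (size s), (fun i => coord (in_tuple s) i (u l)).
  rewrite {1}(coord_span (X := in_tuple s) ul); apply: eq_bigr => i _.
  have i_lt : (i < N - l.+1)%N by rewrite -size_s.
  by rewrite (nth_map 0%N) ?size_iota // nth_iota.
apply: contrapT => /forallNP dep.
have free_u j : (j <= N)%N -> free [seq u i | i <- iota (N - j) j].
  elim: j => [|j IHj] jN; first by rewrite nil_free.
  have := dep (N - j.+1)%N; rewrite /= free_cons.
  have -> : (N - j.+1).+1 = (N - j)%N by rewrite -subSn.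
  have -> : (N - (N - j))%N = j by rewrite subKn // ltnW.
  rewrite IHj ?andbT; last exact: ltnW.
  by move=> nu; apply/negP => uin; apply: nu; split=> //; lia.
have := free_u N (leqnn N); rewrite /free size_map size_iota => /eqP dimN.
by have := dimvS (subvf <<[seq u i | i <- iota (N - N) N]>>); rewrite dimN ltnn.
Qed.

End LinearAlgebra.

(** * Duality over a finite dimensional algebra *)
Section FiniteDimensional.
Variables (k : fieldType) (H : falgType k).
Implicit Types M P Y : lmodType H.

(** [k]-linearity of a map on an [H]-module, with [k] acting through its image in
    the center of [H]. *)
Definition ksemilinear M (V : lmodType k) (u : M -> V) :=
  forall (c : k) (x y : M), u ((c%:A : H) *: x + y) = c *: u x + u y.

Section KLinear.
Variables (M : lmodType H) (V : lmodType k) (u : M -> V).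
Hypothesis lin_u : ksemilinear u.

Lemma ksemilinearD x y : u (x + y) = u x + u y.
Proof. by have := lin_u 1 x y; rewrite !scale1r. Qed.

Lemma ksemilinear0 : u 0 = 0.
Proof. by apply: (addrI (u 0)); rewrite -ksemilinearD !addr0. Qed.

Lemma ksemilinearZ c x : u ((c%:A : H) *: x) = c *: u x.
Proof. by rewrite -[X in u X]addr0 lin_u ksemilinear0 addr0. Qed.

Lemma ksemilinearB x y : u (x - y) = u x - u y.
Proof.
apply: (addIr (u y)); rewrite -ksemilinearD !subrK //.
Qed.

Lemma ksemilinear_sum (D : finType) (F : D -> M) :
  u (\sum_d F d) = \sum_d u (F d).
Proof. exact: (big_morph u ksemilinearD ksemilinear0). Qed.
End KLinear.

(** Multiply the generators with a basis of [H]. *)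
Lemma fin_gen_kspan M : fin_gen M ->
  exists (D : finType) (x : D -> M), forall y, exists c : D -> k,
    y = \sum_d ((c d)%:A : H) *: x d.
Proof.
move=> [n [e gen_e]]; pose b := vbasis {:H}.
exists ('I_n * 'I_(\dim {:H}))%type, (fun d => b`_(val d.2) *: e d.1) => y.
have [h ->] := gen_e y.
exists (fun d => coord b d.2 (h d.1)).
rewrite -(pair_bigA _ (fun i j => ((coord b j (h i))%:A : H) *: (b`_j *: e i))).
apply: eq_bigr => i _ /=; rewrite {1}(coord_vbasis (memvf (h i))) scaler_suml.
by apply: eq_bigr => j _; rewrite scalerA mulr_algl.
Qed.

Definition ffun_dim n := \dim {: {ffun 'I_n -> H}}.

Lemma rV_coords n : exists u : 'rV[H]_n -> 'rV[k]_(ffun_dim n),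
  ksemilinear u /\ injective u.
Proof.
rewrite /ffun_dim dimvf.
exists (fun v => v2r [ffun j => v 0 j]); split=> [c v w|v w /(can_inj v2rK)].
  rewrite -linearP; congr v2r; apply/ffunP => j.
  by rewrite !ffunE !mxE mulr_algl.
by move=> /ffunP vw; apply/rowP => j; have := vw j; rewrite !ffunE.
Qed.

Section Duality.
Variables (n : nat) (Y0 Y : lmodType H) (delta : {linear Y0 -> Y}).

(** The components of [mu] span the [k]-dual of the cokernel of [delta]. *)
Lemma coker_coords (i : {linear Y -> 'rV[H]_n}) : injective i ->
  exists mu : Y -> 'rV[k]_(ffun_dim n),
    ksemilinear mu /\ forall y, mu y = 0 <-> exists x, delta x = y.
Proof.
move=> inj_i; have [u [lin_u inj_u]] := rV_coords n.
have lin_ui : ksemilinear (u \o i) by move=> c x y; rewrite /= linearP lin_u.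
have [||B SB] := @subspace_matrix _ _ (fun v => exists x, u (i (delta x)) = v).
- by exists 0; rewrite !linear0 (ksemilinear0 lin_u).
- move=> c _ _ [x <-] [y <-]; exists ((c%:A : H) *: x + y).
  by rewrite !linearP lin_u.
exists (fun y => u (i y) *m cokermx B); split.
  by move=> c x y; rewrite linearP lin_u mulmxDl scalemxAl.
move=> y; split=> [/eqP|[x <-]].
  by rewrite -submxE => /SB[x /inj_u/inj_i]; exists x.
by apply/eqP; rewrite -submxE; apply/SB; exists x.
Qed.

Variables (N : nat) (mu : Y -> 'rV[k]_N).
Hypothesis lin_mu : ksemilinear mu.
Hypothesis ker_mu : forall y, mu y = 0 <-> exists x, delta x = y.

(** The relations form a right [H]-submodule; here its generators over [k] are
    the columns of [A]. Their number is padded to one depending only on [N]. *)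
Lemma relation_matrix : exists A : 'M[H]_(N, ffun_dim N),
  (forall j y, \sum_l mu (A l j *: y) 0 l = 0) /\
  forall a : 'I_N -> H, (forall y, \sum_l mu (a l *: y) 0 l = 0) ->
    exists w : 'I_(ffun_dim N) -> k, forall l, a l = \sum_j w j *: A l j.
Proof.
have [||A [SA genA]] := @vect_subspace_gen k {ffun 'I_N -> H}
    (fun a => forall y, \sum_l mu (a l *: y) 0 l = 0).
- move=> y; apply: big1 => l _.
  by rewrite ffunE scale0r (ksemilinear0 lin_mu) mxE.
- move=> c a b Sa Sb y.
  transitivity (c * (\sum_l mu (a l *: y) 0 l) + \sum_l mu (b l *: y) 0 l).
    rewrite mulr_sumr -big_split.
    apply: eq_bigr => l _; rewrite !ffunE /= -[c *: _]mulr_algl.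
    by rewrite scalerDl -scalerA lin_mu !mxE.
  by rewrite Sa Sb mulr0 addr0.
exists (\matrix_(l, j) A j l); split=> [j y|a Sa].
  by rewrite -[RHS](SA j y); apply: eq_bigr => l _; rewrite mxE.
have [|w aE] := genA [ffun l => a l].
  by move=> y; rewrite -[RHS](Sa y); apply: eq_bigr => l _; rewrite ffunE.
exists w => l; have /ffunP/(_ l) := aE; rewrite ffunE => ->.
by rewrite sum_ffunE; apply: eq_bigr => j _; rewrite !ffunE mxE.
Qed.

(** Tensoring with a finitely generated projective module [P1] is exact, so
    that a tuple of elements of [P1] on which [mu] vanishes is a combination
    of the relations holding for the components of [mu]. *)
Lemma relation_lift (A : 'M[H]_(N, ffun_dim N)) P1 (z : 'I_N -> P1) :
  (forall a : 'I_N -> H, (forall y, \sum_l mu (a l *: y) 0 l = 0) ->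
    exists w : 'I_(ffun_dim N) -> k, forall l, a l = \sum_j w j *: A l j) ->
  fin_gen P1 -> projective P1 ->
  (forall h : {linear P1 -> Y}, \sum_l mu (h (z l)) 0 l = 0) ->
  exists p : 'I_(ffun_dim N) -> P1, forall l, z l = \sum_j A l j *: p j.
Proof.
move=> genA genP projP zmu; have [m retr] := fin_gen_retract genP projP.
have {retr}[i [p pi]] := retr m (leqnn m).
have coord_rel b : exists w : 'I_(ffun_dim N) -> k,
    forall l, i (z l) 0 b = \sum_j w j *: A l j.
  apply: genA => y.
  have lin_h : linear (fun x => i x 0 b *: y).
    by move=> a x x'; rewrite linearP !mxE scalerDl scalerA.
  exact: (zmu (mklin lin_h)).
have [w wE] := fin_all_exists coord_rel.
exists (fun j => \sum_b ((w b j)%:A : H) *: p (delta_mx 0 b)) => l.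
rewrite -[LHS]pi [i (z l)]rV_lincomb lincomb_comp /=.
under [RHS]eq_bigr do rewrite scaler_sumr.
rewrite exchange_big; apply: eq_bigr => b _; rewrite wE scaler_suml.
by apply: eq_bigr => j _; rewrite scalerA mulr_algr.
Qed.

(** The tuples [q] represent the functionals on [Hom(P, Y)] that vanish on the
    morphisms factoring through [delta]. If no [q] distinguishes [f] from the
    morphisms [h \o d], then [mu] cannot distinguish [f] from one of them, and
    their difference lifts along [delta]. *)
Lemma factor_or_functional P P1 (d : {linear P -> P1}) (f : {linear P -> Y}) :
  fin_gen P -> projective P ->
  ~ (exists (h : {linear P1 -> Y}) (s : {linear P -> Y0}),
       forall x, f x = h (d x) + delta (s x)) ->
  exists q : 'I_N -> P,
    (forall h : {linear P1 -> Y}, \sum_l mu (h (d (q l))) 0 l = 0) /\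
    \sum_l mu (f (q l)) 0 l <> 0.
Proof.
move=> genP projP nf; have [D [x spanx]] := fin_gen_kspan genP.
pose F (g : P -> Y) (t : 'I_N * D) := mu (g (x t.2)) 0 t.1.
have [||nS|c [c0 cF]] := @separation k ('I_N * D)%type
    (fun u => exists h : {linear P1 -> Y}, F (h \o d) = u) (F f).
- exists \0; apply: funext => t; by rewrite /F /= (ksemilinear0 lin_mu) mxE.
- move=> a _ _ [g <-] [h <-].
  have lin_gh : linear (fun y => (a%:A : H) *: g y + h y).
    move=> b u v; rewrite !linearP !scalerDr !scalerA mulr_algl mulr_algr.
    by rewrite addrACA.
  exists (mklin lin_gh); apply: funext => t.
  by rewrite /F /= lin_mu !mxE.
- have [h Fh] := nS; apply: nf.
  have lin_fh : linear (fun y => f y - h (d y)).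
    move=> b u v; rewrite (linearP f) (linearP d) (linearP h) scalerBr.
    by rewrite opprD addrACA.
  have im_fh y : exists z, delta z = mklin lin_fh y.
    apply/ker_mu; rewrite /= (ksemilinearB lin_mu); apply/eqP.
    have [a ->] := spanx y; rewrite !linear_sum !(ksemilinear_sum lin_mu).
    rewrite subr_eq0; apply/eqP/eq_bigr => e _.
    rewrite !linearZ !(ksemilinearZ lin_mu); congr (_ *: _).
    by apply/rowP => l; have /(congr1 (fun G => G (l, e))) := Fh.
  have [s sE] := projective_lift projP im_fh.
  by exists h, s => y; rewrite sE /= addrC subrK.
pose q l := \sum_e ((c (l, e))%:A : H) *: x e.
have qE (g : {linear P -> Y}) :
    \sum_l mu (g (q l)) 0 l = \sum_t c t * F g t.
  transitivity (\sum_l \sum_e c (l, e) * F g (l, e)); last first.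
    by rewrite pair_bigA; apply: eq_bigr => -[].
  apply: eq_bigr => l _; rewrite linear_sum (ksemilinear_sum lin_mu) summxE.
  by apply: eq_bigr => e _; rewrite linearZ (ksemilinearZ lin_mu) mxE.
exists q; split; last by rewrite qE.
by move=> h; have := qE (h \o d) => /= ->; apply: c0; exists h.
Qed.

End Duality.
End FiniteDimensional.

(** * The category of periodic complexes *)
Notation "g \oc f" := (phom_comp g f) (at level 40, left associativity).

Section Category.
Variables (H : nzRingType) (m : nat).
Implicit Types W X Y Z : pcomplex H m.

Lemma phom_ext X Y (f g : phom X Y) : pheq f g -> f = g.
Proof.
case: f g => [f cf] [g cg] fg.
have e : f = g.
  by apply: functional_extensionality_dep => i; apply: linear_ext; apply: fg.
by case: g / e cg fg => cg _; rewrite (Prop_irrelevance cf cg).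
Qed.

Lemma pheqP X Y (f g : phom X Y) : pheq f g <-> f = g.
Proof. by split=> [|->]; first exact: phom_ext. Qed.

Definition phom_opp X Y (f : phom X Y) : phom X Y :=
  phom_sub (phom_zero X Y) f.

HB.instance Definition _ X Y := gen_eqMixin (phom X Y).
HB.instance Definition _ X Y := gen_choiceMixin (phom X Y).

Fact phom_addA X Y : associative (@phom_add H m X Y).
Proof. by move=> f g h; apply: phom_ext => i x /=; rewrite addrA. Qed.
Fact phom_addC X Y : commutative (@phom_add H m X Y).
Proof. by move=> f g; apply: phom_ext => i x /=; rewrite addrC. Qed.
Fact phom_add0 X Y : left_id (phom_zero X Y) (@phom_add H m X Y).
Proof. by move=> f; apply: phom_ext => i x /=; rewrite add0r. Qed.
Fact phom_addN X Y :
  left_inverse (phom_zero X Y) (@phom_opp X Y) (@phom_add H m X Y).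
Proof. by move=> f; apply: phom_ext => i x /=; rewrite sub0r addNr. Qed.

HB.instance Definition _ X Y := GRing.isZmodule.Build (phom X Y)
  (@phom_addA X Y) (@phom_addC X Y) (@phom_add0 X Y) (@phom_addN X Y).

Lemma phom_subE X Y (f g : phom X Y) : phom_sub f g = f - g.
Proof. by apply: phom_ext => i x /=; rewrite sub0r. Qed.

Lemma phomDE X Y (f g : phom X Y) i x : (f + g) i x = f i x + g i x.
Proof. by []. Qed.
Lemma phomNE X Y (f : phom X Y) i x : (- f) i x = - f i x.
Proof. by rewrite /= sub0r. Qed.
Lemma phom0E X Y i x : (0 : phom X Y) i x = 0.
Proof. by []. Qed.
Lemma phom_compE X Y Z (g : phom Y Z) (f : phom X Y) i x :
  (g \oc f) i x = g i (f i x).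
Proof. by []. Qed.
Lemma phom_idE X i x : phom_id X i x = x.
Proof. by []. Qed.

Definition phomE := (phomDE, phomNE, phom0E, phom_compE, phom_idE).

Lemma phom_compA W X Y Z (h : phom Y Z) (g : phom X Y) (f : phom W X) :
  h \oc (g \oc f) = h \oc g \oc f.
Proof. exact: phom_ext. Qed.
Lemma comp1l X Y (f : phom X Y) : phom_id Y \oc f = f.
Proof. exact: phom_ext. Qed.
Lemma comp1r X Y (f : phom X Y) : f \oc phom_id X = f.
Proof. exact: phom_ext. Qed.
Lemma compDl X Y Z (g h : phom Y Z) (f : phom X Y) :
  (g + h) \oc f = g \oc f + h \oc f.
Proof. exact: phom_ext. Qed.
Lemma compDr X Y Z (g h : phom X Y) (f : phom Y Z) :
  f \oc (g + h) = f \oc g + f \oc h.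
Proof. by apply: phom_ext => i x; rewrite !phomE linearD. Qed.
Lemma comp0l X Y Z (f : phom X Y) : (0 : phom Y Z) \oc f = 0.
Proof. exact: phom_ext. Qed.
Lemma comp0r X Y Z (f : phom Y Z) : f \oc (0 : phom X Y) = 0.
Proof. by apply: phom_ext => i x; rewrite !phomE linear0. Qed.
Lemma compNl X Y Z (g : phom Y Z) (f : phom X Y) : (- g) \oc f = - (g \oc f).
Proof. by apply: phom_ext => i x; rewrite !phomE. Qed.
Lemma compNr X Y Z (g : phom Y Z) (f : phom X Y) : g \oc (- f) = - (g \oc f).
Proof. by apply: phom_ext => i x; rewrite !phomE linearN. Qed.
Lemma compBl X Y Z (g h : phom Y Z) (f : phom X Y) :
  (g - h) \oc f = g \oc f - h \oc f.
Proof. by rewrite compDl compNl. Qed.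
Lemma compBr X Y Z (g h : phom X Y) (f : phom Y Z) :
  f \oc (g - h) = f \oc g - f \oc h.
Proof. by rewrite compDr compNr. Qed.
Lemma comp_sumr X Y Z (g : phom Y Z) n (f : 'I_n -> phom X Y) :
  g \oc (\sum_i f i) = \sum_i g \oc f i.
Proof. exact: (big_morph (phom_comp g) (fun x y => compDr x y g) (comp0r _ g)). Qed.
Lemma sectionP X Y (f : phom X Y) :
  is_section f <-> exists r, r \oc f = phom_id X.
Proof. by split=> -[r rf]; exists r; apply/pheqP. Qed.
Lemma retractionP X Y (f : phom X Y) :
  is_retraction f <-> exists s, f \oc s = phom_id Y.
Proof. by split=> -[r rf]; exists r; apply/pheqP. Qed.
Lemma isoP X Y (f : phom X Y) :
  is_iso f <-> exists g, g \oc f = phom_id X /\ f \oc g = phom_id Y.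
Proof. by split=> -[g [gf fg]]; exists g; split; apply/pheqP. Qed.
Lemma radicalP X Y (f : phom X Y) :
  radical f <-> forall g, is_iso (phom_id X - g \oc f).
Proof. by split=> rad g; have := rad g; rewrite phom_subE. Qed.

Lemma iso_comp X Y Z (g : phom Y Z) (f : phom X Y) :
  is_iso g -> is_iso f -> is_iso (g \oc f).
Proof.
move=> /isoP[g' [g'g gg']] /isoP[f' [f'f ff']]; apply/isoP; exists (f' \oc g').
have e : f' \oc g' \oc (g \oc f) = f' \oc (g' \oc g) \oc f by rewrite !phom_compA.
have e' : g \oc f \oc (f' \oc g') = g \oc (f \oc f') \oc g' by rewrite !phom_compA.
by rewrite e e' g'g ff' !comp1r.
Qed.

Lemma iso_id X : is_iso (phom_id X).
Proof. by apply/isoP; exists (phom_id X); rewrite comp1l. Qed.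

Lemma iso_section X Y (f : phom X Y) : is_iso f -> is_section f.
Proof. by move=> /isoP[g [gf _]]; apply/sectionP; exists g. Qed.

Lemma iso_retraction X Y (f : phom X Y) : is_iso f -> is_retraction f.
Proof. by move=> /isoP[g [_ fg]]; apply/retractionP; exists g. Qed.

Lemma zero_comp_iso X Y (f : phom X X) (g : phom X Y) :
  is_iso f -> g \oc f = 0 -> g = 0.
Proof.
by move=> /isoP[f' [_ ff']] gf; rewrite -[g]comp1r -ff' phom_compA gf comp0l.
Qed.

(** If [c] is inverse to [1 - a b], then [1 + b c a] is inverse to [1 - b a]. *)
Lemma iso_sub_comp_swap X Y (a : phom Y X) (b : phom X Y) :
  is_iso (phom_id X - a \oc b) -> is_iso (phom_id Y - b \oc a).
Proof.
move=> /isoP[c [cl cr]]; apply/isoP; exists (phom_id Y + b \oc c \oc a).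
rewrite compBr comp1r in cl; rewrite compBl comp1l in cr.
have cl' : c \oc (a \oc b) = c - phom_id X by rewrite -cl opprB addrC subrK.
have cr' : a \oc b \oc c = c - phom_id X by rewrite -cr opprB addrC subrK.
split.
  rewrite compBr comp1r compDl comp1l.
  have -> : b \oc c \oc a \oc (b \oc a) = b \oc (c \oc (a \oc b)) \oc a.
    by rewrite !phom_compA.
  by rewrite cl' compBr comp1r compBl addrCA subrr addr0 addrK.
rewrite compBl comp1l compDr comp1r.
have -> : b \oc a \oc (b \oc c \oc a) = b \oc (a \oc b \oc c) \oc a.
  by rewrite !phom_compA.
by rewrite cr' compBr comp1r compBl addrCA subrr addr0 addrK.
Qed.

Lemma is_zeroP X : is_zero X <-> phom_id X = 0.
Proof.
split=> [X0|id0 i x]; last by rewrite -[x](phom_idE (X := X)) id0.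
by apply: phom_ext => i x; apply: X0.
Qed.

Lemma radical_comp_l X Y Z (f : phom X Y) (g : phom Y Z) :
  radical f -> radical (g \oc f).
Proof. by move=> /radicalP rad; apply/radicalP => h; rewrite phom_compA. Qed.

Lemma radical_comp_r X Y Z (f : phom X Y) (g : phom Y Z) :
  radical g -> radical (g \oc f).
Proof.
move=> /radicalP rad; apply/radicalP => h.
by rewrite phom_compA; apply: iso_sub_comp_swap; rewrite phom_compA.
Qed.

Lemma radical0 X Y : radical (0 : phom X Y).
Proof. by apply/radicalP => g; rewrite comp0r subr0; apply: iso_id. Qed.

Lemma radicalD X Y (f g : phom X Y) : radical f -> radical g -> radical (f + g).
Proof.
move=> /radicalP radf /radicalP radg; apply/radicalP => h.
have iso_f := radf h; have /isoP[e [ef fe]] := iso_f.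
rewrite compDr opprD addrA.
set a := phom_id X - h \oc f in iso_f ef fe *.
have -> : a - h \oc g = a \oc (phom_id X - (e \oc h) \oc g).
  by rewrite compBr comp1r !phom_compA fe comp1l.
exact: iso_comp.
Qed.

Lemma radical_not_section X Y (f : phom X Y) :
  radical f -> ~ is_zero X -> ~ is_section f.
Proof.
move=> /radicalP rad nzX /sectionP[r rf]; have := rad r.
rewrite rf subrr => iso0; apply/nzX/is_zeroP.
exact: (zero_comp_iso iso0 (comp0r _ _)).
Qed.

End Category.

(** * Kernels, shifts and extensions of complexes *)
Section Constructions.
Variables (H : nzRingType) (m : nat).
Implicit Types W X Y Z : pcomplex H m.

Definition cx_fin_gen X i : fin_gen (X i) := @pobj_fin_gen H m X i.
Definition cx_projective X i : projective (X i) :=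
  fun M N p f => @pobj_projective H m X i M N p f.

Arguments cx_fin_gen : clear implicits.
Arguments cx_projective : clear implicits.

Section Kernel.
Hypothesis herH : hereditary H.
Variables (E T : pcomplex H m) (u : phom E T).

Fact ker_diff_subproof i (x : ker_mod (u i)) :
  u (ordS i) ((pdiff E i \o ker_incl (u i)) x) = 0.
Proof. by rewrite [LHS]pmap_comm (ker_inclP x) linear0. Qed.

Fact ker_diff_sq0 i x :
  ker_corestr (@ker_diff_subproof (ordS i)) (ker_corestr (@ker_diff_subproof i) x) = 0.
Proof. by apply: ker_incl_inj; apply: pdiff_sq0. Qed.

Fact ker_fin_gen i : fin_gen (ker_mod (u i)).
Proof.
by case: (@ker_mod_fin_gen_proj _ _ _ (u i) herH (cx_projective T i)
  (cx_projective E i) (cx_fin_gen E i)).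
Qed.

Fact ker_projective i : projective (ker_mod (u i)).
Proof.
by case: (@ker_mod_fin_gen_proj _ _ _ (u i) herH (cx_projective T i)
  (cx_projective E i) (cx_fin_gen E i)).
Qed.

Definition ker_cx : pcomplex H m :=
  PComplex ker_fin_gen ker_projective ker_diff_sq0.

Definition ker_cx_incl : phom ker_cx E :=
  @PHom _ _ ker_cx E (fun i => ker_incl (u i)) (fun i x => erefl).

Lemma ker_cx_comp : u \oc ker_cx_incl = 0.
Proof. by apply: phom_ext => i x; apply: (ker_inclP x). Qed.

Lemma ker_cx_incl_inj W (v w : phom W ker_cx) :
  ker_cx_incl \oc v = ker_cx_incl \oc w -> v = w.
Proof.
move=> vw; apply: phom_ext => i x; apply: ker_incl_inj.
by have /pheqP/(_ i x) := vw.
Qed.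

Lemma ker_cx_lift W (v : phom W E) :
  u \oc v = 0 -> exists w, v = ker_cx_incl \oc w.
Proof.
move=> /pheqP uv0.
have comm i (x : W i) : ker_corestr (uv0 (ordS i)) (pdiff W i x) =
    pdiff ker_cx i (ker_corestr (uv0 i) x).
  by apply: ker_incl_inj; apply: (pmap_comm v).
by exists (@PHom _ _ W ker_cx (fun i => ker_corestr (uv0 i)) comm); apply: phom_ext.
Qed.

(** The splittings exist in each degree but need not be compatible with the
    differential. *)
Lemma ker_cx_summand i : exists p : {linear E i -> ker_cx i},
  forall x, p (ker_cx_incl i x) = x.
Proof.
have [e [ue eK]] := hereditary_ker_proj (u i) herH (cx_projective T i).
exists (ker_corestr ue) => x; apply: ker_incl_inj; apply: eK; exact: ker_inclP.
Qed.

End Kernel.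

Section Shift.
Variable X : pcomplex H m.

Fact shift_sq0 i (x : X (ordS i)) :
  (-%R \o pdiff X (ordS (ordS i))) ((-%R \o pdiff X (ordS i)) x) = 0.
Proof. by rewrite /= linearN pdiff_sq0 !oppr0. Qed.

Definition shift : pcomplex H m :=
  @PComplex _ _ (fun i => X (ordS i)) (fun i => -%R \o pdiff X (ordS i))
    (fun i => cx_fin_gen X (ordS i)) (fun i => cx_projective X (ordS i))
    shift_sq0.

End Shift.

Definition shift_map X Y (f : phom X Y) : phom (shift X) (shift Y).
Proof.
refine (@PHom _ _ (shift X) (shift Y) (fun i => f (ordS i)) _) => i x /=.
by rewrite linearN pmap_comm.
Defined.

(** Morphisms [W -> shift X] up to [null] are the extensions of [W] by [X]. *)
Definition null W X (phi : phom W (shift X)) : Prop :=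
  exists s : forall i, {linear W i -> X i},
    forall i x, phi i x = s (ordS i) (pdiff W i x) - pdiff X i (s i x).

Lemma null0 W X : null (0 : phom W (shift X)).
Proof. by exists (fun i => \0) => i x; rewrite /= linear0 subr0. Qed.

Lemma nullD W X (f g : phom W (shift X)) : null f -> null g -> null (f + g).
Proof.
move=> [s fs] [t gt]; exists (fun i => s i \+ t i) => i x.
by rewrite phomDE fs gt /= linearD opprD addrACA.
Qed.

Lemma null_comp W' W X (f : phom W (shift X)) (u : phom W' W) :
  null f -> null (f \oc u).
Proof.
move=> [s fs]; exists (fun i => s i \o u i) => i x.
by rewrite phom_compE fs /= pmap_comm.
Qed.

Lemma null_shift W X Y (f : phom W (shift X)) (u : phom X Y) :
  null f -> null (shift_map u \oc f).
Proof.
move=> [s fs]; exists (fun i => u i \o s i) => i x.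
by rewrite phom_compE fs /= linearB pmap_comm.
Qed.

Section Extension.
Variables (X Z : pcomplex H m) (phi : phom Z (shift X)).

Fact ext_diff_is_linear i :
  linear (fun z : X i * Z i => (pdiff X i z.1 + phi i z.2, pdiff Z i z.2) :
    X (ordS i) * Z (ordS i)).
Proof.
move=> a u v; congr (_, _); last by rewrite /= linearP.
by rewrite /= !linearP scalerDr addrACA.
Qed.

Fact ext_sq0 i (z : (X i * Z i)%type) :
  mklin (@ext_diff_is_linear (ordS i)) (mklin (@ext_diff_is_linear i) z) = 0.
Proof.
congr (_, _); rewrite /= ?linearD !pdiff_sq0 // add0r.
by rewrite (pmap_comm phi) /= subrr.
Qed.

(** The middle term of the extension with class [phi]: in degree [i] it is
    [X i * Z i], and the differential is triangular with entry [phi]. *)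
Definition ext_cx : pcomplex H m :=
  @PComplex _ _ (fun i => (X i * Z i)%type) (fun i => mklin (@ext_diff_is_linear i))
    (fun i => fin_gen_prod (cx_fin_gen X i) (cx_fin_gen Z i))
    (fun i => projective_prod (cx_projective X i) (cx_projective Z i))
    ext_sq0.

Fact ext_in_comm i (x : X i) :
  prod_inl (X (ordS i)) (Z (ordS i)) (pdiff X i x) =
  pdiff ext_cx i (prod_inl (X i) (Z i) x).
Proof. by congr (_, _); rewrite /= linear0 ?addr0. Qed.

Definition ext_in : phom X ext_cx :=
  @PHom _ _ X ext_cx (fun i => prod_inl (X i) (Z i)) ext_in_comm.

Definition ext_out : phom ext_cx Z :=
  @PHom _ _ ext_cx Z (fun i => snd) (fun i x => erefl).

Lemma ext_conflation : conflation ext_in ext_out.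
Proof.
move=> i; split=> [x y [] // |y|].
  split=> [y0|[x <-] //]; exists y.1; move: y0.
  by case: y => y1 y2 /= ->.
by exists (prod_inr (X i) (Z i)).
Qed.

Lemma ext_out_in : ext_out \oc ext_in = 0.
Proof. exact: phom_ext. Qed.

Lemma ext_cokernel T (u : phom ext_cx T) :
  u \oc ext_in = 0 -> exists v, u = v \oc ext_out.
Proof.
move=> /pheqP u0.
have uE i (z : ext_cx i) : u i z = u i (prod_inr (X i) (Z i) z.2).
  rewrite [in LHS](prod_split z) linearD.
  by have /= -> := u0 i z.1; rewrite add0r.
have comm i (z : Z i) : (u (ordS i) \o prod_inr _ _) (pdiff Z i z) =
    pdiff T i ((u i \o prod_inr _ _) z).
  by rewrite /= -(pmap_comm u) [in RHS]uE.
by exists (PHom comm); apply: phom_ext => i z; apply: uE.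
Qed.

(** The homotopy splitting the pulled back extension is the first component of
    the lift; dually for [ext_extend] and the pushout. *)
Lemma ext_lift W (u : phom W Z) :
  null (phi \oc u) -> exists v, ext_out \oc v = u.
Proof.
move=> [s us].
have lin_v i : linear (fun x : W i => (s i x, u i x) : X i * Z i).
  by move=> a x y; congr (_, _); rewrite /= !linearP.
have comm i x : mklin (lin_v (ordS i)) (pdiff W i x) =
    pdiff ext_cx i (mklin (lin_v i) x).
  congr (_, _); rewrite /= ?pmap_comm //.
  by have /= -> := us i x; rewrite addrC subrK.
by exists (@PHom _ _ W ext_cx (fun i => mklin (lin_v i)) comm); apply: phom_ext.
Qed.

Lemma ext_extend W (u : phom X W) :
  null (shift_map u \oc phi) -> exists v, v \oc ext_in = u.
Proof.
move=> [s us].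
have lin_v i : linear (fun z : X i * Z i => u i z.1 - s i z.2).
  by move=> a x y; rewrite /= (linearP (u i)) (linearP (s i)) scalerBr opprD addrACA.
have comm i (x : ext_cx i) : mklin (lin_v (ordS i)) (pdiff ext_cx i x) =
    pdiff W i (mklin (lin_v i) x).
  rewrite /= linearD linearB -!pmap_comm -addrA; congr (_ + _).
  by have /= -> := us i x.2; rewrite addrAC subrr add0r.
exists (@PHom _ _ ext_cx W (fun i => mklin (lin_v i)) comm).
by apply: phom_ext => i x; rewrite /= linear0 subr0.
Qed.

Lemma ext_split_null : is_retraction ext_out -> null phi.
Proof.
move=> /retractionP[v /pheqP vK].
have v2 i z : (v i z).2 = z by apply: vK.
exists (fun i => fst \o v i) => i z /=.
have /(congr1 fst) /= -> := pmap_comm v z.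
by rewrite v2 addrC addKr.
Qed.

End Extension.

End Constructions.

Arguments cx_fin_gen [H m] X i.
Arguments cx_projective [H m] X i M N p f _.

(** * Endomorphism rings and Fitting's lemma *)
Section EndomorphismRing.
Variables (H : nzRingType) (m : nat).
Implicit Types W X Y Z : pcomplex H m.

(** A name of its own for the endomorphisms lets them carry a ring structure next
    to the group structure that all morphism sets have. *)
Definition endo X := phom X X.
HB.instance Definition _ X := GRing.Zmodule.on (endo X).

Fact endo_mulA X : associative (fun f g : endo X => f \oc g).
Proof. exact: (fun f g h : phom X X => phom_compA f g h). Qed.
Fact endo_mul1 X : left_id (phom_id X) (fun f g : endo X => f \oc g).
Proof. exact: (fun f : phom X X => comp1l f). Qed.
Fact endo_mulr1 X : right_id (phom_id X) (fun f g : endo X => f \oc g).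
Proof. exact: (fun f : phom X X => comp1r f). Qed.
Fact endo_mulDl X :
  left_distributive (fun f g : endo X => f \oc g) +%R.
Proof. exact: (fun f g h : phom X X => compDl f g h). Qed.
Fact endo_mulDr X :
  right_distributive (fun f g : endo X => f \oc g) +%R.
Proof. exact: (fun f g h : phom X X => compDr g h f). Qed.

HB.instance Definition _ X := GRing.Zmodule_isPzRing.Build (endo X)
  (@endo_mulA X) (@endo_mul1 X) (@endo_mulr1 X) (@endo_mulDl X) (@endo_mulDr X).

Lemma endo_isoP X (t s : endo X) : t * s = 1 -> s * t = 1 -> is_iso t.
Proof. by move=> ts st; apply/isoP; exists s. Qed.

Lemma direct_sum X Y : exists D (iX : phom X D) (iY : phom Y D)
    (pX : phom D X) (pY : phom D Y),
  [/\ pX \oc iX = phom_id X, pY \oc iY = phom_id Y, pX \oc iY = 0,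
      pY \oc iX = 0 & iX \oc pX + iY \oc pY = phom_id D].
Proof.
pose D := ext_cx (0 : phom Y (shift X)).
have p_comm i (z : D i) : (pdiff D i z).1 = pdiff X i z.1.
  by rewrite /= addr0.
have i_comm i (y : Y i) : prod_inr _ _ (pdiff Y i y) =
    pdiff D i (prod_inr _ _ y).
  by congr (_, _); rewrite /= linear0 addr0.
exists D, (ext_in _), (@PHom _ _ Y D (fun i => prod_inr (X i) (Y i)) i_comm),
  (@PHom _ _ D X (fun i => fst) p_comm), (ext_out _).
split; apply: phom_ext => // i z.
by rewrite /= -(prod_split z).
Qed.

Hypothesis herH : hereditary H.

(** The summand cut out by [e] is the kernel of [1 - e]. *)
Lemma idempotent_split X (e : phom X X) : e \oc e = e ->
  exists Z (i : phom Z X) (p : phom X Z), p \oc i = phom_id Z /\ i \oc p = e.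
Proof.
move=> ee; pose u := phom_id X - e.
have [|p eE] := @ker_cx_lift _ _ herH _ _ u _ e.
  by rewrite compBl comp1l ee subrr.
pose i := ker_cx_incl herH u; exists (ker_cx herH u), i, p; split=> //.
apply: (@ker_cx_incl_inj _ _ herH _ _ u); rewrite phom_compA -eE comp1r.
have := ker_cx_comp herH u; rewrite compBl comp1l => /subr0_eq ->.
by [].
Qed.

Lemma indecomposable_idempotent X (e : phom X X) :
  indecomposable X -> e \oc e = e -> e = 0 \/ e = phom_id X.
Proof.
move=> [nzX indX] ee; pose e' := phom_id X - e.
have ee' : e \oc e' = 0 by rewrite compBr comp1r ee subrr.
have e'e : e' \oc e = 0 by rewrite compBl comp1l ee subrr.
have e'e' : e' \oc e' = e' by rewrite {2}/e' compBr comp1r e'e subr0.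
have [A [iA [pA [pAiA iApA]]]] := idempotent_split ee.
have [B [iB [pB [pBiB iBpB]]]] := idempotent_split e'e'.
have [|/is_zeroP A0|/is_zeroP B0] := indX A B.
- exists iA, iB, pA, pB; split; apply/pheqP => //.
  + rewrite -[pA]comp1l -[iB]comp1r -pAiA -pBiB.
    have -> : pA \oc iA \oc pA \oc (iB \oc (pB \oc iB)) =
      pA \oc ((iA \oc pA) \oc (iB \oc pB)) \oc iB by rewrite !phom_compA.
    by rewrite iApA iBpB ee' comp0r comp0l.
  + rewrite -[pB]comp1l -[iA]comp1r -pAiA -pBiB.
    have -> : pB \oc iB \oc pB \oc (iA \oc (pA \oc iA)) =
      pB \oc ((iB \oc pB) \oc (iA \oc pA)) \oc iA by rewrite !phom_compA.
    by rewrite iApA iBpB e'e comp0r comp0l.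
  + by rewrite iApA iBpB; exact: (etrans (addrC e e') (subrK e _)).
- by left; rewrite -iApA -[pA]comp1l A0 comp0l comp0r.
right; apply/esym/subr0_eq; rewrite -/e' -iBpB -[pB]comp1l B0.
by rewrite comp0l comp0r.
Qed.

End EndomorphismRing.

Section Fitting.
Variables (R : pzRingType) (t s : R) (l : nat).
Hypotheses (ts : t * s = s * t) (tl : t ^+ l = t ^+ l.+1 * s).

Lemma fitting_absorb n : t ^+ l * (t * s) ^+ n = t ^+ l.
Proof.
elim: n => [|n IHn]; first by rewrite mulr1.
by rewrite exprS mulrA mulrA -exprSr -tl.
Qed.

(** Right multiplication by [e = (t s)^l] fixes [t^l], and [e = s^l t^l]. *)
Lemma fitting_idempotent : (t * s) ^+ l * (t * s) ^+ l = (t * s) ^+ l.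
Proof.
have E : (t * s) ^+ l = s ^+ l * t ^+ l by rewrite ts exprMn_comm.
by rewrite {1 3}E -mulrA fitting_absorb.
Qed.

Lemma fitting_nilpotent : (t * s) ^+ l = 0 -> t ^+ l = 0.
Proof. by move=> e0; rewrite -(fitting_absorb l) e0 mulr0. Qed.

Lemma fitting_inverse : (t * s) ^+ l = 1 -> t * s = 1.
Proof.
have E : (t * s) ^+ l = s ^+ l * t ^+ l by rewrite ts exprMn_comm.
move=> e1; rewrite -[LHS]mul1r -{1}e1 E -mulrA.
by have := fitting_absorb 1; rewrite expr1 => ->; rewrite -E.
Qed.
End Fitting.

Lemma nilpotent_one_sub (R : pzRingType) (t : R) l : t ^+ l = 0 ->
  exists s, (1 - t) * s = 1 /\ s * (1 - t) = 1.
Proof.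
move=> tl; exists (\sum_(i < l) t ^+ i).
have E : (1 - t) * (\sum_(i < l) t ^+ i) = 1.
  by rewrite -[1 - t]opprB mulNr -subrX1 tl sub0r opprK.
split=> //; rewrite -[RHS]E; apply/esym/commr_sum => i _.
apply/commrX/commr_sym/commrB; [exact: commr1 | exact: commr_refl].
Qed.

Section Finiteness.
Variables (k : fieldType) (H : falgType k) (m : nat).
Implicit Types W X Y Z : pcomplex H m.

Fact scal_is_linear X (c : k) i : linear (fun x : X i => (c%:A : H) *: x).
Proof. by move=> a x y; rewrite scalerDr !scalerA mulr_algl mulr_algr. Qed.

Fact scal_comm_diff X (c : k) i (x : X i) :
  mklin (@scal_is_linear X c (ordS i)) (pdiff X i x) =
  pdiff X i (mklin (@scal_is_linear X c i) x).
Proof. by rewrite /= linearZ. Qed.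

(** Multiplication by a scalar, as an endomorphism: sums of compositions with
    such endomorphisms stand for linear combinations of morphisms. *)
Definition scal X (c : k) : phom X X :=
  @PHom _ _ X X (fun i => mklin (@scal_is_linear X c i)) (@scal_comm_diff X c).

Lemma scalE X c i x : scal X c i x = (c%:A : H) *: x.
Proof. by []. Qed.

Lemma scal_comm X Y c (f : phom X Y) : f \oc scal X c = scal Y c \oc f.
Proof. by apply: phom_ext => i x; rewrite !phom_compE !scalE linearZ. Qed.

(** Each term is a retract of a free module, of one rank for all degrees. *)
Lemma cx_retract X : exists N
  (r : forall i, {linear X i -> 'rV[H]_N} * {linear 'rV[H]_N -> X i}),
  forall i x, (r i).2 ((r i).1 x) = x.
Proof.
have retr i := fin_gen_retract (cx_fin_gen X i) (cx_projective X i).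
have [n0 n0P] := fin_all_exists retr.
exists (\max_i n0 i).
apply: (@fin_all_exists 'I_m
  (fun i => ({linear X i -> 'rV[H]_(\max_i n0 i)} *
             {linear 'rV[H]_(\max_i n0 i) -> X i})%type)
  (fun i r => forall x, r.2 (r.1 x) = x)) => i.
have [u [v uv]] := n0P i (\max_i n0 i) (leq_bigmax i).
by exists (u, v).
Qed.

(** A morphism is determined by a matrix over [H] in each degree, so that
    morphism spaces are finite dimensional over [k]. *)
Lemma phom_seq_dep X Y (t : nat -> phom X Y) :
  exists l n (c : 'I_n -> k), t l = \sum_(i < n) t (l.+1 + i)%N \oc scal X (c i).
Proof.
have [N [r rK]] := cx_retract X; have [N' [r' r'K]] := cx_retract Y.
pose J (f : phom X Y) : {ffun 'I_m * 'I_N * 'I_N' -> H} :=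
  [ffun d => (r' d.1.1).1 (f d.1.1 ((r d.1.1).2 (delta_mx 0 d.1.2))) 0 d.2].
have J0 : J 0 = 0.
  by apply/ffunP => d; rewrite !ffunE phom0E linear0 mxE.
have JD f g : J (f + g) = J f + J g.
  by apply/ffunP => d; rewrite !ffunE phomDE linearD mxE.
have JZ f c : J (f \oc scal X c) = c *: J f.
  by apply/ffunP => d; rewrite !ffunE phom_compE scalE !linearZ mxE mulr_algl.
have J_inj : injective J.
  move=> f g /ffunP fg; apply: phom_ext => i x.
  rewrite -[x]rK [(r i).1 x]rV_lincomb !lincomb_comp.
  apply: eq_bigr => j _; congr (_ *: _).
  rewrite -[LHS]r'K -[RHS]r'K; congr ((r' i).2 _); apply/rowP => j'.
  by have := fg (i, j, j'); rewrite !ffunE.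
have [l [n [c tl]]] := vect_seq_dep (fun i => J (t i)).
exists l, n, c; apply: J_inj; rewrite tl (big_morph J JD J0).
by apply: eq_bigr => i _; rewrite JZ.
Qed.

Hypothesis herH : hereditary H.

(** Fitting's lemma: a linear relation between the powers of [t] yields an
    idempotent polynomial in [t], which is [0] or [1]; accordingly [t] is
    nilpotent or invertible. *)
Lemma indecomposable_local X (t : phom X X) :
  indecomposable X -> is_iso t \/ is_iso (phom_id X - t).
Proof.
move=> indX; pose T : endo X := t.
(* [t ^+ l] is a combination of higher powers of [t], and [s] is the
   corresponding polynomial in [t]. *)
have [l [n [c tl]]] := phom_seq_dep (fun i => T ^+ i : phom X X).
pose s : endo X := \sum_(i < n) (T ^+ i * (scal X (c i) : endo X)).
have Ts : T * s = s * T.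
  apply: commr_sum => i _; apply: commrM; first exact/commrX/commr_refl.
  exact: scal_comm.
have Tl : T ^+ l = T ^+ l.+1 * s.
  rewrite [LHS]tl mulr_sumr; apply: eq_bigr => i _.
  by rewrite mulrA -exprD.
have ee := fitting_idempotent Ts Tl.
have [e0|e1] := indecomposable_idempotent herH indX ee.
  have [s' [ts' st']] := nilpotent_one_sub (fitting_nilpotent Tl e0).
  by right; apply: (@endo_isoP _ _ _ _ s').
left; have T1 := fitting_inverse Ts Tl e1.
by apply: (@endo_isoP _ _ _ _ s) => //; rewrite -Ts.
Qed.

Lemma not_section_radical X Y (f : phom X Y) :
  indecomposable X -> ~ is_section f -> radical f.
Proof.
move=> indX nf; apply/radicalP => g.
have [/isoP[h [hg _]]|//] := indecomposable_local (g \oc f) indX.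
by case: nf; apply/sectionP; exists (h \oc g); rewrite -phom_compA.
Qed.

Lemma not_retraction_radical X Y (f : phom X Y) :
  indecomposable Y -> ~ is_retraction f -> radical f.
Proof.
move=> indY nf; apply/radicalP => g; apply: iso_sub_comp_swap.
have [/isoP[h [_ hg]]|//] := indecomposable_local (f \oc g) indY.
by case: nf; apply/retractionP; exists (g \oc h); rewrite phom_compA.
Qed.

Lemma indecomposable_section_iso X Y (f : phom X Y) :
  ~ is_zero X -> indecomposable Y -> is_section f -> is_iso f.
Proof.
move=> nzX indY /sectionP[r rf].
have [|f0|fr] := @indecomposable_idempotent _ _ herH _ (f \oc r) indY.
- by rewrite phom_compA -[f \oc r \oc f]phom_compA rf comp1r.
- case: nzX; apply/is_zeroP.
  have <- : r \oc (f \oc r) \oc f = phom_id X.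
    by rewrite phom_compA rf comp1l.
  by rewrite f0 comp0r comp0l.
by apply/isoP; exists r.
Qed.

End Finiteness.

(** * A test object for extensions *)
Lemma ordS_onto m (j : 'I_m) : exists i, ordS i = j.
Proof. by exists (ord_pred j); apply: ord_predK. Qed.

(** Constructions in degree [i + 1] define a family over all degrees, because the
    successor is a bijection of the degrees; this avoids transport along
    [i = (i - 1) + 1]. *)
Lemma ordS_family m (T : 'I_m -> Type) (R : forall i, T (ordS i) -> Prop) :
  (forall i, exists t, R i t) -> exists t : forall j, T j, forall i, R i (t (ordS i)).
Proof.
move=> RT.
have RT' j : exists t : T j, forall i (e : ordS i = j), R i (ecast j (T j) (esym e) t).
  have [i0 <-] := ordS_onto j; have [t Rt] := RT i0; exists t => i e.
  have ii0 := ordS_inj e; case: _ / ii0 t Rt e => t Rt e.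
  by rewrite (Prop_irrelevance e erefl).
have [t tP] := fin_all_exists RT'.
by exists t => i; apply: (tP (ordS i) i erefl).
Qed.

Section TestObject.
Variables (k : fieldType) (H : falgType k) (m : nat).
Implicit Types V W X Y Z : pcomplex H m.
Hypothesis herH : hereditary H.

(** Projecting onto the cycles and onto a complement of them makes homotopies
    chosen independently in each degree compatible. *)
Lemma degreewise_null W X (phi : phom W (shift X)) :
  (forall i, exists (h : {linear W (ordS i) -> X (ordS i)}) (s : {linear W i -> X i}),
     forall x, phi i x = h (pdiff W i x) + pdiff X i (s x)) ->
  null phi.
Proof.
move=> /(ordS_family (T := fun j => {linear W j -> X j})
  (R := fun i h => exists s : {linear W i -> X i},
     forall x, phi i x = h (pdiff W i x) + pdiff X i (s x)))[h].
move=> /fin_all_exists[s phiE].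
have /fin_all_exists[e eP] i :=
  hereditary_ker_proj (pdiff X i) herH (cx_projective X (ordS i)).
(* On the cycles the homotopy is [h], on their complement it is [- s]. *)
pose S i := (e i \o h i) \- (s i \- (e i \o s i)).
exists S => i x; set y := pdiff W i x.
have [de _] := eP i; have [_ eK] := eP (ordS i).
have {de} -> : pdiff X i (S i x) = - pdiff X i (s i x).
  by rewrite /S /= linearB linearB !de subr0 sub0r.
rewrite opprK phiE; congr (_ + _); rewrite /S /= -/y.
have cyc : pdiff X (ordS i) (h (ordS i) y + s (ordS i) y) = 0.
  rewrite linearD; have /= := pmap_comm phi x; rewrite -/y !phiE.
  by rewrite pdiff_sq0 linear0 add0r linearD pdiff_sq0 addr0 => ->; rewrite subrr.
rewrite opprB addrA -linearD eK //.
by rewrite addrK.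
Qed.

Section Test.
Variables (n c : nat) (A : 'I_m -> 'M[H]_(n, c)).

Fact test_diff_is_linear i :
  linear (fun z : 'rV[H]_n * 'rV[H]_c => (0, z.1 *m A i) : 'rV[H]_n * 'rV[H]_c).
Proof.
move=> a u v; congr (_, _); first by rewrite /= scaler0 addr0.
by rewrite /= mulmxDl scalemxAl.
Qed.

Fact test_sq0 i z :
  mklin (test_diff_is_linear (ordS i)) (mklin (test_diff_is_linear i) z) = 0.
Proof. by congr (_, _); rewrite /= mul0mx. Qed.

(** The direct sum over all degrees [i] of the two term complexes given by [A i]
    in the degrees [i] and [i + 1]; all its terms are the same module. *)
Definition test_cx : pcomplex H m :=
  @PComplex H m (fun i => ('rV[H]_n * 'rV[H]_c)%type)
    (fun i => mklin (test_diff_is_linear i))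
    (fun i => fin_gen_prod (fin_gen_rV H n) (fin_gen_rV H c))
    (fun i => projective_prod (@projective_rV H n) (@projective_rV H c))
    test_sq0.

Variables (W : pcomplex H m) (q : forall j, 'I_n -> W j) (p : forall j, 'I_c -> W j).
Hypothesis dq : forall j l, pdiff W j (q j l) = \sum_b A j l b *: p (ordS j) b.
Hypothesis dp : forall j b, pdiff W j (p j b) = 0.

Fact test_map_is_linear j :
  linear (fun z : 'rV[H]_n * 'rV[H]_c => lincomb (q j) z.1 + lincomb (p j) z.2).
Proof. by move=> a u v; rewrite !linearP scalerDr addrACA. Qed.

Fact test_map_comm j (z : test_cx j) :
  mklin (test_map_is_linear (ordS j)) (pdiff test_cx j z) =
  pdiff W j (mklin (test_map_is_linear j) z).
Proof.
transitivity (lincomb (q (ordS j)) 0 + lincomb (p (ordS j)) (z.1 *m A j)) => //.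
transitivity (pdiff W j (lincomb (q j) z.1 + lincomb (p j) z.2)) => //.
rewrite linear0 add0r linearD !lincomb_comp /= [X in _ + X]big1 ?addr0.
  under eq_bigr do rewrite mxE scaler_suml.
  rewrite exchange_big; apply: eq_bigr => l _; rewrite dq scaler_sumr.
  by apply: eq_bigr => b _; rewrite scalerA.
by move=> b _; rewrite dp scaler0.
Qed.

Definition test_map : phom test_cx W :=
  @PHom _ _ test_cx W (fun j => mklin (test_map_is_linear j)) test_map_comm.

Lemma test_mapE j u v : test_map j (u, v) = lincomb (q j) u + lincomb (p j) v.
Proof. by []. Qed.

End Test.

(** In a degree [i] where [phi] is not homotopic to zero, a separating tuple [q]
    exists, and its boundary is a combination, with the relations [A i] as
    coefficients, of elements [p], which may be projected onto the cycles. This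
    is a morphism from the test complex. If its composite with [phi] were null
    by [s], then [mu] would vanish on the part of [phi (q l)] coming from [A i]
    by definition of the relations, and on the other part, a boundary. *)
Lemma test_object X : exists V, forall W (phi : phom W (shift X)),
  ~ null phi -> exists g : phom V W, ~ null (phi \oc g).
Proof.
have [N [r rK]] := cx_retract X.
pose n := ffun_dim H N; pose c := ffun_dim H n.
have data i : exists muA : (X (ordS i) -> 'rV[k]_n) * 'M[H]_(n, c),
    [/\ ksemilinear muA.1,
        forall y, muA.1 y = 0 <-> exists x, pdiff X i x = y,
        forall j y, \sum_l muA.1 (muA.2 l j *: y) 0 l = 0 &
        forall a : 'I_n -> H, (forall y, \sum_l muA.1 (a l *: y) 0 l = 0) ->
          exists w : 'I_c -> k, forall l, a l = \sum_j w j *: muA.2 l j].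
  have [|mu [lin_mu ker_mu]] :=
    @coker_coords _ _ N _ _ (pdiff X i) (r (ordS i)).1.
    exact: can_inj (rK (ordS i)).
  by have [A [relA genA]] := relation_matrix lin_mu; exists (mu, A).
have {data} [muA muAP] := fin_all_exists data.
pose A i := (muA i).2; exists (test_cx A) => W phi nphi.
have [i nphi_i] : exists i,
    ~ exists (h : {linear W (ordS i) -> X (ordS i)}) (s : {linear W i -> X i}),
      forall x, phi i x = h (pdiff W i x) + pdiff X i (s x).
  by apply: contrapT => /forallNP cphi; apply/nphi/degreewise_null => i;
    apply: contrapT; apply: cphi.
have [lin_mu ker_mu relA genA] := muAP i; set mu := (muA i).1 in lin_mu ker_mu relA genA.
have [q [q0 q1]] := factor_or_functional lin_mu ker_mu (cx_fin_gen W i)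
  (cx_projective W i) nphi_i.
have [p pE] := relation_lift genA (cx_fin_gen W (ordS i))
  (cx_projective W (ordS i)) q0.
have [e [de eK]] := hereditary_ker_proj (pdiff W (ordS i)) herH
  (cx_projective W (ordS (ordS i))).
pose Q := dfwith (T := fun j => 'I_n -> W j) (fun j _ => 0) q.
pose P := dfwith (T := fun j => 'I_c -> W j) (fun j _ => 0)
  (fun b => e (p b) : W (ordS i)).
have dQ j l : pdiff W j (Q j l) = \sum_b A j l b *: P (ordS j) b.
  have [<-|ij] := eqVneq i j.
    rewrite /Q /P !dfwith_in -[LHS]eK ?pdiff_sq0 // pE linear_sum.
    by apply: eq_bigr => b _; rewrite linearZ.
  rewrite /Q /P !dfwith_out // ?linear0; last by rewrite (inj_eq (@ordS_inj m)).
  by rewrite big1 // => b _; rewrite scaler0.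
have dP j b : pdiff W j (P j b) = 0.
  rewrite /P; have [<-|ij] := eqVneq (ordS i) j; first by rewrite dfwith_in de.
  by rewrite dfwith_out // linear0.
exists (test_map dQ dP) => -[s sE].
apply: q1; rewrite -/mu.
have phiq l : phi i (q l) =
    \sum_b A i l b *: s (ordS i) (0, delta_mx 0 b) -
    pdiff X i (s i (delta_mx 0 l, 0)).
  have -> : q l = test_map dQ dP i (delta_mx 0 l, 0).
    by rewrite test_mapE linear0 addr0 lincomb_delta /Q dfwith_in.
  rewrite -[LHS]/((phi \oc test_map dQ dP) i _) sE; congr (_ - _).
  transitivity (s (ordS i) (prod_inr _ _ (delta_mx 0 l *m A i))).
    by [].
  rewrite -rowE [row l (A i)]rV_lincomb !lincomb_comp.
  by apply: eq_bigr => b _; rewrite mxE.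
transitivity (\sum_b \sum_l mu (A i l b *: s (ordS i) (0, delta_mx 0 b)) 0 l).
  rewrite exchange_big; apply: eq_bigr => l _ /=.
  rewrite phiq (ksemilinearB lin_mu).
  have /ker_mu -> : exists x, pdiff X i x = pdiff X i (s i (delta_mx 0 l, 0)).
    by exists (s i (delta_mx 0 l, 0)).
  by rewrite subr0 (ksemilinear_sum lin_mu) summxE.
by apply: big1 => b _; apply: relA.
Qed.

End TestObject.

(** * Almost split sequences *)
Section ExtensionMorphisms.
Variables (H : nzRingType) (m : nat).
Implicit Types V W X Y Z : pcomplex H m.

(** Inverses of linear bijections commute with the differentials. *)
Lemma bij_iso X Y (f : phom X Y) :
  (forall i, injective (f i)) -> (forall i y, exists x, f i x = y) -> is_iso f.
Proof.
move=> inj_f surj_f.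
have inv_f i : exists g : {linear Y i -> X i}, forall y, f i (g y) = y.
  have [g fg] := choice (surj_f i).
  have lin_g : linear g.
    by move=> a x y; apply: inj_f; rewrite linearP !fg.
  by exists (mklin lin_g).
have [g fg] := fin_all_exists inv_f.
have comm i y : g (ordS i) (pdiff Y i y) = pdiff X i (g i y).
  by apply: inj_f; rewrite fg pmap_comm fg.
apply/isoP; exists (PHom comm); split; apply: phom_ext => i x.
  by apply: inj_f; rewrite phom_compE phom_idE; apply: fg.
exact: fg.
Qed.

Section OneExtension.
Variables (X Z : pcomplex H m) (phi : phom Z (shift X)).

Lemma ext_kernel W (u : phom W (ext_cx phi)) :
  ext_out phi \oc u = 0 -> exists v, u = ext_in phi \oc v.
Proof.
move=> /pheqP u2; have {}u2 i x : (u i x).2 = 0 by apply: u2.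
have uE i x : u i x = ext_in phi i (u i x).1.
  by rewrite [LHS]prod_split u2 linear0 addr0.
have comm i x : (fst \o u (ordS i)) (pdiff W i x) = pdiff X i ((fst \o u i) x).
  rewrite /= pmap_comm uE -pmap_comm //.
by exists (@PHom _ _ W X (fun i => fst \o u i) comm); apply: phom_ext.
Qed.

Lemma ext_out_epi W (u v : phom Z W) :
  u \oc ext_out phi = v \oc ext_out phi -> u = v.
Proof.
move=> /pheqP uv; apply: phom_ext => i z; exact: (uv i (0, z)).
Qed.

Lemma ext_in_section_null : is_section (ext_in phi) -> null phi.
Proof.
move=> /sectionP[r rin]; apply: ext_split_null.
have [|v vE] := @ext_cokernel _ _ _ _ phi _
    (phom_id _ - ext_in phi \oc r).
  by rewrite compBl comp1l -phom_compA rin comp1r subrr.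
apply/retractionP; exists v; apply: ext_out_epi.
rewrite -phom_compA -vE compBr comp1r phom_compA ext_out_in comp0l subr0.
by rewrite comp1l.
Qed.

Variables (X' Z' : pcomplex H m) (psi : phom Z' (shift X')).
Variables (c : phom (ext_cx phi) (ext_cx psi)) (t : phom X X') (s : phom Z Z').
Hypotheses (ct : c \oc ext_in phi = ext_in psi \oc t)
  (cs : ext_out psi \oc c = s \oc ext_out phi).

(** The off-diagonal entry of [c] is the homotopy. *)
Lemma ext_morphism_null : null (psi \oc s - shift_map t \oc phi).
Proof.
pose a i := fst \o (c i \o prod_inr (X i) (Z i)).
have cE i x z : c i (x, z) = (t i x + a i z, s i z).
  have -> : (x, z) = ext_in phi i x + prod_inr _ _ z by apply: prod_split.
  rewrite linearD; have /pheqP/(_ i x) /= -> := ct.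
  have /pheqP/(_ i (0, z)) /= := cs; rewrite /a /=.
  by case: (c i (0, z)) => a1 a2 /= ->; congr (_, _); rewrite /= add0r.
exists a => i z; rewrite phomDE phomNE !phom_compE.
have := pmap_comm c (0 : X i, z) => /=; rewrite !cE /= => /(congr1 fst) /=.
rewrite !linear0 !add0r => E.
have -> : psi i (s i z) = t (ordS i) (phi i z) + a (ordS i) (pdiff Z i z)
    - pdiff X' i (a i z) by rewrite E addrAC subrr add0r.
by rewrite -[_ + _ - pdiff _ _ _]addrA [LHS]addrC addKr.
Qed.

Lemma ext_morphism_iso : is_iso t -> is_iso s -> is_iso c.
Proof.
move=> /isoP[t' [/pheqP t't /pheqP tt']] /isoP[s' [/pheqP s's /pheqP ss']].
have cin i x : c i (ext_in phi i x) = ext_in psi i (t i x).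
  by have /pheqP/(_ i x) := ct.
have outc i y : (c i y).2 = s i y.2 by have /pheqP/(_ i y) := cs.
have inE i (y : ext_cx phi i) : y.2 = 0 -> y = ext_in phi i y.1.
  by move=> y2; rewrite [LHS]prod_split y2 linear0 addr0.
have inE' i (y : ext_cx psi i) : y.2 = 0 -> y = ext_in psi i y.1.
  by move=> y2; rewrite [LHS]prod_split y2 linear0 addr0.
apply: bij_iso => i.
  apply: raddf_inj => y cy.
  have y2 : y.2 = 0.
    by have /= <- := s's i y.2; rewrite -outc cy linear0.
  have y1 : y.1 = 0.
    have : c i (ext_in phi i y.1) = 0 by rewrite -(inE _ _ y2).
    rewrite cin => /(congr1 fst) /= ty; have /= <- := t't i y.1.
    by rewrite ty linear0.
  by rewrite (inE _ _ y2) y1 linear0.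
move=> y; pose w := prod_inr (X i) (Z i) (s' i y.2).
have d2 : (y - c i w).2 = 0.
  by rewrite /= outc /= -[s i _]/((s \oc s') i y.2) ss' subrr.
exists (w + ext_in phi i (t' i (y - c i w).1)).
rewrite linearD cin; have /= -> := tt' i (y - c i w).1.
have /= <- := inE' _ _ d2.
by rewrite addrC subrK.
Qed.

End OneExtension.
End ExtensionMorphisms.

Section AlmostSplit.
Variables (k : fieldType) (H : falgType k) (m : nat).
Implicit Types V W X Y Z : pcomplex H m.
Hypothesis herH : hereditary H.

(** In a sequence with [a_(n+1)] in [a_n End(V)], the right ideals [a_n End(V)]
    form a descending chain of subspaces of a finite dimensional space, so that
    two successive ones agree. *)
Lemma endo_chain V (good : phom V V -> Prop) (rel : phom V V -> phom V V -> Prop) a0 :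
  good a0 -> (forall a, good a -> exists r, rel a r /\ good (a \oc r)) ->
  exists a r b, [/\ good a, rel a r, good (a \oc r) & a = a \oc r \oc b].
Proof.
move=> good0 step.
pose T := {a : phom V V | good a}.
have /choice[f fP] : forall x : T, exists y : T,
    exists r : phom V V, rel (sval x) r /\ sval y = (sval x : phom V V) \oc r.
  move=> [a ga] /=; have [r [rr gr]] := step a ga.
  by exists (exist _ (a \oc r) gr), r.
pose x n : T := iter n f (exist _ a0 good0).
have [l [n [c xl]]] := phom_seq_dep (fun i => sval (x i)).
have [r [rr xr]] := fP (x l).
have descent i : exists b, sval (x (l.+1 + i)%N) = sval (x l.+1) \oc b.
  elim: i => [|i [b IHi]]; first by exists (phom_id V); rewrite addn0 comp1r.
  rewrite addnS; have [r' [_ xr']] := fP (x (l.+1 + i)%N).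
  by exists (b \oc r'); rewrite /x iterS xr' -/x IHi phom_compA.
have /fin_all_exists[b bP] (i : 'I_n) := descent i.
exists (sval (x l)), r, (\sum_i b i \oc scal V (c i)).
have xSl : sval (x l.+1) = (sval (x l) : phom V V) \oc r by [].
split=> //; [exact: svalP | by rewrite -xSl; apply: svalP |].
rewrite -xSl {1}xl comp_sumr; apply: eq_bigr => i _.
by rewrite bP phom_compA.
Qed.

(** Otherwise radical endomorphisms [r_1, r_2, ...] of [V] exist for which all
    products [a_n = r_1 ... r_n] act nontrivially; then [a_n = a_n r b] for some
    [n] and a radical [r], so that [a_n (1 - r b) = 0] and [a_n = 0]. *)
Lemma socle X V (phi0 : phom V (shift X)) :
  (forall W (phi : phom W (shift X)), ~ null phi ->
     exists g : phom V W, ~ null (phi \oc g)) ->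
  ~ null phi0 ->
  exists phi : phom V (shift X), ~ null phi /\
    forall W (r : phom W V), radical r -> null (phi \oc r).
Proof.
move=> detect nphi0; apply: contrapT => /forallNP no_socle.
have [||a [r [b [ga rad_r _ aE]]]] := @endo_chain V
    (fun a => ~ null (phi0 \oc a)) (fun _ r => radical r) (phom_id V).
- by rewrite comp1r.
- move=> a na; have /not_andP[//|] := no_socle (phi0 \oc a).
  move=> /existsNP[W] /existsNP[r] /not_implyP[rad_r nr].
  have [g ng] := detect _ _ nr; exists (r \oc g).
  by split; [apply: radical_comp_r | rewrite !phom_compA].
apply: ga; suff -> : a = 0 by rewrite comp0r; apply: null0.
have /radicalP/(_ b) := rad_r => /iso_sub_comp_swap iso_rb.
apply: (zero_comp_iso iso_rb).
by rewrite compBr comp1r phom_compA -aE subrr.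
Qed.

(** The summand belongs to a minimal idempotent of [End(V)] among those on which
    [phi] is not null. *)
Lemma socle_indecomposable X V (phi : phom V (shift X)) :
  ~ null phi -> (forall W (r : phom W V), radical r -> null (phi \oc r)) ->
  exists Z (psi : phom Z (shift X)), [/\ indecomposable Z, ~ null psi &
    forall W (r : phom W Z), radical r -> null (psi \oc r)].
Proof.
move=> nphi rad_phi.
have [e [ee ne e_min]] : exists e, [/\ e \oc e = e, ~ null (phi \oc e) &
    forall e', e' \oc e' = e' -> e \oc e' = e' -> e' \oc e = e' ->
      ~ null (phi \oc e') -> e' = e].
  apply: contrapT => /forallNP no_min.
  have [||a [e' [b [_ [e'a e'_neq ae'] [e'e' _] aE]]]] := @endo_chain V
      (fun e => e \oc e = e /\ ~ null (phi \oc e))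
      (fun e e' => [/\ e' \oc e = e', e' <> e & e \oc e' = e']) (phom_id V).
  - by rewrite !comp1r.
  - move=> e [ee ne]; have := no_min e; apply: contra_notP => /forallNP no_e'.
    split=> // e' e'e' ee' e'e ne'; apply: contrapT => e'_neq.
    by apply: (no_e' e'); rewrite ee'.
  rewrite ae' in e'e' aE.
  by case: e'_neq; rewrite -e'a [in LHS]aE phom_compA e'e' -aE.
have [Z [i [p [pi ip]]]] := idempotent_split herH ee.
exists Z, (phi \oc i); split; last 2 first.
- by move=> nul; apply: ne; rewrite -ip phom_compA; apply: null_comp.
- move=> W r rad_r; rewrite -phom_compA; apply: rad_phi.
  exact: radical_comp_l.
have half A B (iA : phom A Z) (iB : phom B Z) (pA : phom Z A) (pB : phom Z B) :
    pA \oc iA = phom_id A -> pB \oc iB = phom_id B ->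
    iA \oc pA + iB \oc pB = phom_id Z ->
    ~ null (phi \oc (i \oc (iA \oc pA) \oc p)) -> is_zero B.
  move=> pAiA pBiB sumZ nA; apply/is_zeroP.
  have AA : iA \oc pA \oc (iA \oc pA) = iA \oc pA.
    by rewrite phom_compA -[iA \oc pA \oc iA]phom_compA pAiA comp1r.
  have mulZ (u v : phom Z Z) : i \oc u \oc p \oc (i \oc v \oc p) = i \oc (u \oc v) \oc p.
    by rewrite !phom_compA -[i \oc u \oc p \oc i]phom_compA pi comp1r.
  have eE : e = i \oc phom_id Z \oc p by rewrite comp1r.
  have eAe : i \oc (iA \oc pA) \oc p = e.
    by apply: e_min => //; rewrite ?eE mulZ ?AA ?comp1l ?comp1r.
  have AZ : iA \oc pA = phom_id Z.
    have : p \oc (i \oc (iA \oc pA) \oc p) \oc i = p \oc e \oc i by rewrite eAe.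
    rewrite -ip !phom_compA pi !comp1l -phom_compA pi comp1r => ->.
    by [].
  move: sumZ; rewrite AZ -[X in _ = X]addr0 => /addrI iBpB.
  by rewrite -pBiB -[iB]comp1r -pBiB [iB \oc _]phom_compA iBpB comp0l comp0r.
split.
  move=> /is_zeroP Z0; apply: ne; rewrite -ip -[p]comp1l Z0 comp0l !comp0r.
  exact: null0.
move=> A B [iA [iB [pA [pB [/pheqP pAiA /pheqP pBiB _ _ /pheqP sumZ]]]]].
have [nA|/contrapT nulA] := EM (~ null (phi \oc (i \oc (iA \oc pA) \oc p))).
  by right; apply: (half A B iA iB pA pB).
left; apply: (half B A iB iA pB pA) => //; first by rewrite addrC.
move=> nulB; apply: ne.
rewrite -ip -[p]comp1l -sumZ -[phom_add _ _]/(iA \oc pA + iB \oc pB).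
rewrite compDl !compDr; apply: nullD; rewrite !phom_compA in nulA nulB *; by [].
Qed.

(** Right almost split is the hypothesis on [phi]. For the left half, let [u] be
    a morphism from [X] along which the pushout of [phi] is not null. The
    deflation of the pushout is not a retraction and so lifts to the extension
    [phi]; this lift induces [r] with [r u] fixing [phi] up to null morphisms.
    As [1 - r u] kills the nonsplit [phi], it is not invertible, hence [r u] is,
    and [u] is a section. Minimality is proved in the same way. *)
Lemma almost_split_ext X Z (phi : phom Z (shift X)) :
  indecomposable X -> indecomposable Z -> ~ null phi ->
  (forall W (r : phom W Z), radical r -> null (phi \oc r)) ->
  almost_split_seq (ext_in phi) (ext_out phi).
Proof.
move=> indX indZ nphi rad_phi.
have stable_l (t : phom X X) : null (phi - shift_map t \oc phi) -> is_iso t.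
  move=> nul; have [//|/isoP[e [e_inv _]]] := indecomposable_local herH t indX.
  case: nphi; have := null_shift e nul.
  congr null; rewrite -[RHS]comp1l.
  have <- : shift_map e \oc (phom_id _ - shift_map t) = phom_id (shift X).
    apply: phom_ext => i x; have /pheqP/(_ (ordS i) x) := e_inv.
    by rewrite !phom_compE !phomDE !phomNE.
  by rewrite -phom_compA compBl comp1l.
have stable_r (s : phom Z Z) : null (phi \oc s - phi) -> is_iso s.
  move=> nul; have [//|/isoP[e [_ e_inv]]] := indecomposable_local herH s indZ.
  case: nphi; have := null_comp (- e) nul.
  congr null; rewrite -[RHS]comp1r -e_inv compNr -compNl opprB phom_compA.
  by rewrite compBr comp1r.
have not_retr : ~ is_retraction (ext_out phi).
  by move=> retr; apply/nphi/ext_split_null.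
have lift W (u : phom W Z) : ~ is_retraction u -> exists v, ext_out phi \oc v = u.
  move=> nu; apply/ext_lift/rad_phi; exact: (not_retraction_radical herH).
split; first exact: ext_conflation.
- split=> [sec|W u nu]; first exact/nphi/ext_in_section_null.
  suff nul : null (shift_map u \oc phi).
    by have [v vu] := ext_extend nul; exists v; apply/pheqP.
  apply: contrapT => nnul; pose psi := shift_map u \oc phi.
  have [|v vE] := lift _ (ext_out psi).
    by move=> /ext_split_null.
  have [|r vin] := @ext_kernel _ _ _ _ phi _ (v \oc ext_in psi).
    by rewrite phom_compA vE ext_out_in.
  have nul := @ext_morphism_null _ _ _ _ psi _ _ phi v r (phom_id Z) vin.
  rewrite comp1l comp1r in nul; have {}nul := nul vE.
  have /isoP[e [er _]] : is_iso (r \oc u).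
    apply: stable_l; move: nul; congr (null (_ - _)).
    exact: phom_ext.
  by apply: nu; apply/sectionP; exists (e \oc r); rewrite -phom_compA.
- move=> e /pheqP e_in.
  have [|s outE] := @ext_cokernel _ _ _ _ phi _ (ext_out phi \oc e).
    by rewrite -phom_compA e_in ext_out_in.
  have e_in' : e \oc ext_in phi = ext_in phi \oc phom_id X by rewrite comp1r.
  apply: (ext_morphism_iso e_in' outE); first exact: iso_id.
  apply: stable_r; have := ext_morphism_null e_in' outE; congr (null (_ - _)).
  exact: phom_ext.
- split=> // W u nu; have [v vu] := lift W u nu.
  by exists v; apply/pheqP.
move=> e /pheqP e_out.
have [|t inE] := @ext_kernel _ _ _ _ phi _ (e \oc ext_in phi).
  by rewrite phom_compA e_out ext_out_in.
have e_out' : ext_out phi \oc e = phom_id Z \oc ext_out phi by rewrite comp1l.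
apply: (ext_morphism_iso inE e_out'); last exact: iso_id.
by apply: stable_l; have := ext_morphism_null inE e_out'; rewrite comp1r.
Qed.

Theorem almost_split_exists X : indecomposable X -> ~ null (phom_id (shift X)) ->
  exists Z (phi : phom Z (shift X)), indecomposable Z /\
    almost_split_seq (ext_in phi) (ext_out phi).
Proof.
move=> indX n1; have [V detect] := test_object herH X.
have [g ng] := detect _ _ n1.
have [phi [nphi rad_phi]] := socle detect ng.
have [Z [psi [indZ npsi rad_psi]]] := socle_indecomposable nphi rad_phi.
by exists Z, psi; split=> //; apply: almost_split_ext.
Qed.

End AlmostSplit.

(** * Sectional paths *)
Section SectionalPaths.
Variables (k : fieldType) (H : falgType k) (m : nat).
Implicit Types S T E W X Y Z : pcomplex H m.

(** Powers of the radical with one intermediate object; direct sums absorb the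
    sums occurring in [radical_pow]. *)
Fixpoint rad_power s X Y (f : phom X Y) : Prop :=
  if s is s'.+1 then
    exists S (h : phom X S) (g : phom S Y),
      [/\ radical h, rad_power s' g & f = g \oc h]
  else True.

Lemma rad_power_comp s W X Y (f : phom X Y) (u : phom W X) :
  rad_power s f -> rad_power s (f \oc u).
Proof.
case: s => [//|s] [S [h [g [rad_h pow_g ->]]]].
by exists S, (h \oc u), g; split; rewrite ?phom_compA //; apply: radical_comp_r.
Qed.

Lemma rad_power0 s X Y : rad_power s (0 : phom X Y).
Proof.
elim: s X Y => [//|s IHs] X Y.
by exists Y, 0, 0; split; rewrite ?comp0l //; apply: radical0.
Qed.

Lemma rad_powerD s X Y (f g : phom X Y) :
  rad_power s f -> rad_power s g -> rad_power s (f + g).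
Proof.
elim: s X Y f g => [//|s IHs] X Y _ _ [S [h [u [rad_h pow_u ->]]]]
  [S' [h' [u' [rad_h' pow_u' ->]]]].
have [D [i [i' [p [p' [pi p'i' pi' p'i _]]]]]] := direct_sum S S'.
exists D, (i \oc h + i' \oc h'), (u \oc p + u' \oc p'); split.
- by apply: radicalD; apply: radical_comp_l.
- by apply: IHs; apply: rad_power_comp.
rewrite compDl !compDr.
have E (A B C : pcomplex H m) (a : phom D A) (b : phom A Y) (c : phom B D)
  (d : phom C B) : b \oc a \oc (c \oc d) = b \oc (a \oc c) \oc d by rewrite !phom_compA.
by rewrite !E pi p'i' pi' p'i !comp1r !comp0r !comp0l addr0 add0r.
Qed.

Lemma radical_pow_rad_power s X Y (f : phom X Y) : radical_pow s f -> rad_power s f.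
Proof.
elim: s X Y f => [//|s IHs] X Y f [n [Z [h [g [rad_h pow_g /pheqP ->]]]]].
apply: (big_ind (@rad_power s.+1 X Y)); first exact: rad_power0.
  exact: rad_powerD.
move=> j _; exists (Z j), (h j), (g j).
by split=> //; apply/IHs/pow_g.
Qed.

Lemma radical_pow_zero s X Y (f : phom X Y) :
  pheq f (phom_zero X Y) -> radical_pow s.+1 f.
Proof.
move=> f0; exists 0%N, (fun _ => X), (fun _ => phom_zero X X), (fun _ => phom_zero X Y).
split=> [[j lt_j0]|[j lt_j0]|]; [by []|by []|by rewrite big_ord0].
Qed.

Lemma irreducible_factor X Y W (f : phom X Y) (g : phom X W) (h : phom W Y) :
  irreducible f -> f = h \oc g -> is_section g \/ is_retraction h.
Proof. by move=> [_ _ irr] /pheqP/irr. Qed.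

(** The part of irreducibility that is inherited by the restriction of the end
    of an almost split sequence to a summand of the middle term. *)
Definition prime_mor X Y (f : phom X Y) :=
  ~ is_section f /\ forall W (g : phom X W) (h : phom W Y),
    f = h \oc g -> is_section g \/ is_retraction h.

Definition contractible X := null (phom_id (shift X)).

(** If [t] contracts [X] and [r] is a degreewise retraction of [f], then
    [d t r + t r d] is a chain map, and a retraction of [f]. *)
Lemma contractible_section X E (f : phom X E) : contractible X ->
  (forall i, exists r : {linear E i -> X i}, forall x, r (f i x) = x) ->
  is_section f.
Proof.
move=> [t tE] /fin_all_exists[r rf].
have idE i x : x = pdiff X i (- t i x) + - t (ordS i) (pdiff X (ordS i) x).
  by rewrite linearN addrC -{1}[x](phom_idE (X := shift X)) tE /= linearN.
pose R i (rho : {linear E (ordS i) -> X (ordS i)}) := forall y,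
  rho y = pdiff X i (- t i (r (ordS i) y)) +
    - t (ordS i) (r (ordS (ordS i)) (pdiff E (ordS i) y)).
have ex_rho i : exists rho, @R i rho.
  by exists ((pdiff X i \o (-%R \o t i \o r (ordS i))) \+
    (-%R \o t (ordS i) \o r (ordS (ordS i)) \o pdiff E (ordS i))).
have [rho rhoE] := ordS_family (T := fun j => {linear E j -> X j}) ex_rho.
have comm j y : rho (ordS j) (pdiff E j y) = pdiff X j (rho j y).
  have [i ij] := ordS_onto j; case: _ / ij y => y.
  rewrite !rhoE pdiff_sq0 !linear0 ?oppr0 addr0 linearD pdiff_sq0 add0r.
  by [].
apply/sectionP; exists (PHom comm); apply: phom_ext => j x.
have [i ij] := ordS_onto j; case: _ / ij x => x.
by rewrite phom_compE phom_idE /= rhoE -(pmap_comm f) !rf -idE.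
Qed.

Hypothesis herH : hereditary H.

(** Two irreducible morphisms from [X] to indecomposables which are not
    isomorphic are jointly a quotient of every non-section that they factor
    through. *)
Lemma joint_retraction X Y Z E (f : phom X Y) (p : phom X Z) (c : phom X E)
    (a : phom E Y) (b : phom E Z) :
  indecomposable Y -> irreducible f ->
  p = 0 \/ [/\ indecomposable Z, ~ isomorphic Z Y & prime_mor p] ->
  ~ is_section c -> f = a \oc c -> p = b \oc c ->
  exists s : phom Y E, a \oc s = phom_id Y /\ (p = 0 \/ b \oc s = 0).
Proof.
move=> indY irr_f p_cases nc fE pE.
have [//|/retractionP[al a_al]] := irreducible_factor irr_f fE.
case: p_cases => [->|[indZ nZY [_ prime_p]]]; first by exists al; split=> //; left.
have [//|/retractionP[be b_be]] := prime_p _ _ _ pE.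
have [nzY _] := indY; have [nzZ _] := indZ.
have n_ba : ~ is_section (b \oc al).
  move=> /(indecomposable_section_iso herH nzY indZ)/isoP[t [tl tr]].
  by apply: nZY; exists t; apply/isoP; exists (b \oc al).
have /radicalP/(_ (a \oc be))/isoP[e [_ e_inv]] := not_section_radical herH indY n_ba.
(* [al] is corrected by [be] to be killed by [b]; the effect on [a \oc al] is the
   radical endomorphism [a \oc be \oc (b \oc al)], which [e] compensates. *)
exists ((al - be \oc (b \oc al)) \oc e); split; last right.
  by rewrite phom_compA compBr a_al [a \oc (be \oc _)]phom_compA.
by rewrite phom_compA compBr [b \oc (be \oc _)]phom_compA b_be comp1l subrr comp0l.
Qed.

(** Given [c s = h u] with [h] not a retraction, write [h = c h']. Replacing the
    component of the identity of [E] on the summand [Y] by [h' u] does not change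
    the composite with [c], so the result is invertible by minimality of [c],
    and [u] is a section. *)
Lemma prime_mor_of_almost_split Z Y E X (g : phom X E) (c : phom E Z)
    (a : phom E Y) (s : phom Y E) :
  almost_split_seq g c -> indecomposable Y -> indecomposable Z ->
  a \oc s = phom_id Y -> prime_mor (c \oc s).
Proof.
move=> [_ _ _ [nc c_ras] c_min] [nzY _] indZ as1; split.
  move=> /(indecomposable_section_iso herH nzY indZ)/iso_retraction.
  by move=> /retractionP[u csu]; apply: nc; apply/retractionP; exists (s \oc u);
    rewrite phom_compA.
move=> W u h csE; have [|nh] := EM (is_retraction h); [by right|left].
have [h' /pheqP h'E] := c_ras _ _ nh.
(* the identity of [E] with [s] replaced by [h' \oc u] on the summand [Y] *)
pose e := h' \oc u \oc a + (phom_id E - s \oc a).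
have ces : e \oc s = h' \oc u.
  rewrite compDl compBl -!phom_compA as1 !comp1r comp1l subrr addr0 //.
have /isoP[e' [e'e _]] : is_iso e.
  apply: c_min; apply/pheqP; rewrite compDr compBr comp1r !phom_compA h'E -csE.
  by rewrite addrC subrK.
apply/sectionP; exists (a \oc e' \oc h').
by rewrite -phom_compA -ces -phom_compA [e' \oc _]phom_compA e'e comp1l.
Qed.

(** Here [th] is the rest of the path, and [v] and [p] come from the preceding
    step; [p = 0] at the start of the path and after a contractible term. *)
Lemma sectional_step s X Y Z T (f : phom X Y) (p : phom X Z) (th : phom Y T)
    (v : phom Z T) :
  indecomposable X -> indecomposable Y -> irreducible f ->
  p = 0 \/ [/\ indecomposable Z, ~ isomorphic Z Y & prime_mor p] ->
  rad_power s.+1 (th \oc f - v \oc p) ->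
  exists Z' (p' : phom Y Z') (v' : phom Z' T),
    rad_power s (th - v' \oc p') /\
    (p' = 0 \/ [/\ indecomposable Z', is_tau_inv X Z' & prime_mor p']).
Proof.
move=> indX indY irr_f p_cases [S [h [g [rad_h pow_g fpE]]]].
have [nzX _] := indX.
have nf : ~ is_section f by case: irr_f.
have np : ~ is_section p.
  case: p_cases => [->|[_ _ []//]].
  by apply: radical_not_section nzX; apply: radical0.
have nh := radical_not_section rad_h nzX.
(* If [p = 0], then [v] can be anything, and taking it to be [0] makes [v \oc b]
   vanish for every [b]. *)
have {fpE v} [v [fpE v0]] : exists v : phom Z T,
    th \oc f - v \oc p = g \oc h /\ (p = 0 -> v = 0).
  have [p0|p_neq0] := EM (p = 0); last by exists v.
  by exists 0; split=> //; rewrite -fpE p0 !comp0r.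
have factor E (c : phom X E) a b w :
    ~ is_section c -> f = a \oc c -> p = b \oc c -> h = w \oc c ->
    exists s : phom Y E, [/\ a \oc s = phom_id Y, v \oc b \oc s = 0 &
      (th \oc a - v \oc b - g \oc w) \oc c = 0].
  move=> nc fE pE hE.
  have [s' [as1 bs0]] := joint_retraction indY irr_f p_cases nc fE pE.
  exists s'; split=> //.
    by case: bs0 => [/v0 ->|bs0]; rewrite ?comp0l // -phom_compA bs0 comp0r.
  by rewrite !compBl -!phom_compA -fE -pE -hE fpE subrr.
have [cX|ncX] := EM (contractible X).
  (* [c] has the components [f], [p] and [h]; its corestriction to the kernel of
     the combination of projections that kills it is again not a section. *)
  have [D [iY [iD [pY [pD [pYiY pDiD pYiD pDiY _]]]]]] := direct_sum Y Z.
  have [E [jD [jS [qD [qS [qDjD qSjS qDjS qSjD _]]]]]] := direct_sum D S.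
  pose c := jD \oc (iY \oc f + iD \oc p) + jS \oc h.
  have qDc : qD \oc c = iY \oc f + iD \oc p.
    by rewrite compDr !phom_compA qDjD qDjS comp1l comp0l addr0.
  have fE : f = (pY \oc qD) \oc c.
    by rewrite -phom_compA qDc compDr !phom_compA pYiY pYiD comp1l comp0l addr0.
  have pE : p = (pD \oc qD) \oc c.
    by rewrite -phom_compA qDc compDr !phom_compA pDiY pDiD comp1l comp0l add0r.
  have hE : h = qS \oc c.
    by rewrite compDr !phom_compA qSjS qSjD comp1l comp0l add0r.
  have nc : ~ is_section c.
    apply: radical_not_section nzX; apply: radicalD; last exact: radical_comp_l.
    apply/radical_comp_l/radicalD; apply: radical_comp_l;
      exact: (not_section_radical herH).
  have [_ [_ _ uc0]] := factor _ _ _ _ _ nc fE pE hE.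
  have [K [i [c' [cE ui summand_i]]]] : exists K (i : phom K E) (c' : phom X K),
      [/\ c = i \oc c', (th \oc (pY \oc qD) - v \oc (pD \oc qD) - g \oc qS) \oc i = 0
        & forall j, exists e : {linear E j -> K j}, forall x, e (i j x) = x].
    have [c' cE] := ker_cx_lift herH uc0.
    exists (ker_cx herH _), (ker_cx_incl herH _), c'; split=> //.
      exact: ker_cx_comp.
    exact: ker_cx_summand.
  have nc' : ~ is_section c'.
    move=> /sectionP[r /pheqP rc']; apply/nc/contractible_section => // j.
    have [e eK] := summand_i j.
    exists (r j \o e) => x; rewrite cE phom_compE /= eK; exact: rc'.
  have lift_c' W (q : phom X W) (t : phom E W) : q = t \oc c -> q = t \oc i \oc c'.
    by rewrite cE phom_compA.
  have [s' [as1 vbs0 _]] :=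
    factor _ _ _ _ _ nc' (lift_c' _ _ _ fE) (lift_c' _ _ _ pE) (lift_c' _ _ _ hE).
  exists X, 0, 0; split; last by left.
  rewrite comp0l subr0 -[th]comp1r -as1.
  have -> : th \oc (pY \oc qD \oc i \oc s') = g \oc (qS \oc i \oc s').
    move: vbs0 (congr1 (fun q => q \oc s') ui).
    by rewrite !compBl comp0l !phom_compA => ->; rewrite subr0 => /subr0_eq.
  exact: rad_power_comp.
have [Z' [phi [indZ' ass]]] := almost_split_exists herH indX ncX.
have [_ [nin las] _ _ _] := ass.
have lift W (q : phom X W) : ~ is_section q -> exists a, q = a \oc ext_in phi.
  by move=> /las[a /pheqP aE]; exists a.
have [a fE] := lift _ _ nf; have [b pE] := lift _ _ np; have [w hE] := lift _ _ nh.
have [s' [as1 vbs0 uc0]] := factor _ _ _ _ _ nin fE pE hE.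
have [v' v'E] := ext_cokernel uc0.
exists Z', (ext_out phi \oc s'), v'; split; last first.
  right; split=> //; last exact: (prime_mor_of_almost_split ass indY indZ' as1).
  by exists (ext_cx phi), (ext_in phi), (ext_out phi).
rewrite phom_compA -v'E !compBl vbs0 subr0 -[th \oc a \oc s']phom_compA as1 comp1r.
by rewrite opprB addrC subrK -phom_compA; apply: rad_power_comp.
Qed.

Lemma path_comp_recl (X : nat -> pcomplex H m) (f : forall i, phom (X i) (X i.+1)) n :
  path_comp f n.+1 = path_comp (fun i => f i.+1) n \oc f 0%N.
Proof.
elim: n => [|n IHn]; first by rewrite /= comp1l comp1r.
by rewrite -[LHS]/(f n.+1 \oc path_comp f n.+1) IHn phom_compA.
Qed.

(** The path starting at [X 1] is handled by shifting the indices; the hypothesis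
    on [p] is what [sectional_step] hands on. *)
Lemma sectional_path_rad_power r (X : nat -> pcomplex H m)
    (f : forall i, phom (X i) (X i.+1)) Z (p : phom (X 0%N) Z) (v : phom Z (X r)) :
  (forall i, (i <= r)%N -> indecomposable (X i)) ->
  (forall i, (i < r)%N -> irreducible (f i)) ->
  (forall i, (i.+2 <= r)%N ->
     forall Z, is_tau_inv (X i) Z -> ~ isomorphic Z (X i.+2)) ->
  p = 0 \/ [/\ indecomposable Z, (0 < r)%N -> ~ isomorphic Z (X 1%N) & prime_mor p] ->
  ~ rad_power r.+1 (path_comp f r - v \oc p).
Proof.
elim: r X f Z p v => [|r IHr] X f Z p v indX irr_f sect p_cases.
  move=> [S [h [g [/radicalP/(_ g) + _ gh]]]]; rewrite -gh opprB addrC subrK.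
  move=> /iso_section/sectionP[u]; have [nzX _] := indX 0%N isT.
  case: p_cases => [->|[_ _ [np _]]] uvp.
    by apply/nzX/is_zeroP; rewrite -uvp !comp0r.
  by apply/np/sectionP; exists (u \oc v); rewrite -phom_compA.
rewrite path_comp_recl => pow.
have {}p_cases : p = 0 \/ [/\ indecomposable Z, ~ isomorphic Z (X 1%N) & prime_mor p].
  by case: p_cases => [|[? /(_ isT) ? ?]]; [left | right].
have [Z' [p' [v' [pow' p'_cases]]]] :=
  sectional_step (indX 0%N isT) (indX 1%N isT) (irr_f 0%N isT) p_cases pow.
apply: (IHr (fun i => X i.+1) (fun i => f i.+1) Z' p' v' _ _ _ _ pow').
- by move=> i ir; apply: indX.
- by move=> i ir; apply: irr_f.
- by move=> i ir; apply: sect.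
case: p'_cases => [|[indZ' tau prime_p']]; [by left | right; split=> //].
by move=> r_gt0; apply: (sect 0%N).
Qed.

End SectionalPaths.

Theorem corollary5p5 (k : fieldType) (H : falgType k) (m r : nat)
    (X : nat -> pcomplex H m)
    (f : forall i : nat, phom (X i) (X i.+1)) :
  hereditary H ->
  (2 <= m)%N ->
  sectional_path r X ->
  (forall i : nat, (i < r)%N -> irreducible (f i)) ->
  ~ radical_pow r.+1 (path_comp f r) /\
  ~ pheq (path_comp f r) (phom_zero (X 0%N) (X r)).
Proof.
move=> herH _ [indX _ sect] irr_f.
have nrad : ~ radical_pow r.+1 (path_comp f r).
  move=> /radical_pow_rad_power pow.
  apply: (@sectional_path_rad_power _ _ _ herH r X f (X 0%N) 0 0 indX irr_f sect).
    by left.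
  by rewrite comp0l subr0.
by split=> // /radical_pow_zero.
Qed.
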